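(* The series $\Omega_q$ is regular at $q=1$ (i.e. none of its coefficients, which are elements of $\mathbb{Q}(q)$, has a pole at $q=1$), and its value at $q=1$ is $\Omega_{q=1}=\Omega$.
   Context: For a field $K$ ($K=\mathbb{Q}$ or $\mathbb{Q}(q)$, $q$ an indeterminate), $\mathrm{PL}=\bigoplus_{n\ge1}\mathrm{PL}_n$ is the $K$-vector space with basis the isomorphism classes of (unlabeled, non-planar) rooted trees, graded by the number $\#T$ of vertices. The pre-Lie product is $T\curvearrowleft T'=\sum_{v}$ (tree obtained from $T\sqcup T'$ by adding an edge from the root of $T'$ to $v$), sum over vertices $v$ of $T$, the root being that of $T$. Denote by $\bullet$ the one-vertex tree; $\mathrm{PL}$ is the free (right) pre-Lie algebra on $\bullet$, and a Lie algebra for $[x,y]=x\curvearrowleft y-y\curvearrowleft x$. Let $\widehat{\mathrm{PL}}=\prod_{n\ge1}\mathrm{PL}_n$ and let $\widehat U(\mathrm{PL})$ be the (degree-)completed universal enveloping algebra, with associative product $\star$. The product $\curvearrowleft$ is a right action of the Lie algebra, so extends to a right action of $\widehat U(\mathrm{PL})$ on $\widehat{\mathrm{PL}}$: $x\curvearrowleft(u\star v)=(x\curvearrowleft u)\curvearrowleft v$. Exponentials are computed in $\widehat U(\mathrm{PL})$. $\Omega\in\widehat{\mathrm{PL}}_{\mathbb{Q}}$ is the unique solution of $\bullet\curvearrowleft\left(\frac{\Omega}{\exp(\Omega)-1}\right)=\Omega$, where $\frac{x}{e^x-1}$ is expanded as a power series. For $A=\sum_{n\ge 1}A_n$ (homogeneous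 components), $A[q]=\sum_n q^nA_n$. $\Omega_q\in\widehat{\mathrm{PL}}_{\mathbb{Q}(q)}$ is the unique solution of $$\Omega_q[q]\curvearrowleft(\exp(\Omega)-1)+\Omega_q[q]-\Omega_q=\bullet\curvearrowleft\Omega_q+(q-1)\bullet .$$ *)

(* Defs.v *)
From Stdlib Require List.
From HB Require Import structures.
From mathcomp Require Import all_boot all_order all_algebra.
From mathcomp Require Import generic_quotient ring_quotient fraction.
From mathcomp Require Import boolp functions.

Set Implicit Arguments.
Unset Strict Implicit.
Unset Printing Implicit Defensive.

Import GRing.Theory.
Local Open Scope ring_scope.

(* Planar rooted trees; a non-planar rooted tree is represented below by the
   canonical planar tree of its isomorphism class. *)
Inductive ptree : Type := Node of seq ptree.

Lemma ptree_In_ind (P : ptree -> Prop) :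
  (forall s, (forall t, List.In t s -> P t) -> P (Node s)) -> forall t, P t.
Proof.
move=> H; exact: (fix IH t := match t with Node s =>
  H s ((fix IHs s : forall t, List.In t s -> P t :=
    match s with
    | [::] => fun t (f : False) => match f with end
    | a :: s' => fun t h => match h with
                            | or_introl e => eq_ind a P (IH a) t e
                            | or_intror h' => IHs s' t h' end
    end) s) end).
Qed.

Fixpoint ptree_code (t : ptree) : GenTree.tree void :=
  let: Node s := t in GenTree.Node 0 (map ptree_code s).
Fixpoint ptree_decode (c : GenTree.tree void) : ptree :=
  if c is GenTree.Node _ s then Node (map ptree_decode s) else Node [::].
Lemma ptree_codeK : cancel ptree_code ptree_decode.
Proof.
elim/ptree_In_ind => s /= IH; congr Node; elim: s IH => //= a s IHs IH.
by rewrite IH ?IHs //; [move=> t ts; apply: IH; right | left].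
Qed.
HB.instance Definition _ := Countable.copy ptree (can_type ptree_codeK).

Lemma ptree_mem_ind (P : ptree -> Prop) :
  (forall s, {in s, forall t, P t} -> P (Node s)) -> forall t, P t.
Proof.
move=> H; elim/ptree_In_ind => s IH; apply: H => t; elim: s IH => //= a s IHs IH.
by rewrite inE => /orP[/eqP->|ts]; [apply: IH; left | apply: IHs => // u us; apply: IH; right].
Qed.

Fixpoint tsize (t : ptree) : nat := let: Node s := t in (sumn (map tsize s)).+1.

Definition leT : rel ptree := fun t u => (pickle t <= pickle u)%N.

Lemma leT_total : total leT. Proof. by move=> t u; exact: leq_total. Qed.
Lemma leT_trans : transitive leT. Proof. by move=> t u v; exact: leq_trans. Qed.
Lemma leT_anti : antisymmetric leT.
Proof. by move=> t u; rewrite -eqn_leq => /eqP/(pcan_inj pickleK). Qed.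

(* canon sorts the list of children of every vertex for the (arbitrary) total
   order leT.  By canon_Node_eq, canon t = canon u iff t is turned into u by
   permuting the children of its vertices, i.e., iff t and u are planar
   embeddings of the same rooted tree. *)
Fixpoint canon (t : ptree) : ptree :=
  let: Node s := t in Node (sort leT (map canon s)).

Lemma canon_Node_eq s t :
  (canon (Node s) == canon (Node t)) = perm_eq (map canon s) (map canon t).
Proof.
apply/eqP/idP => /= [[/eqP]|/(perm_sortP leT_total leT_trans leT_anti)-> //].
by move/eqP/(perm_sortP leT_total leT_trans leT_anti).
Qed.

Lemma canonK t : canon (canon t) = canon t.
Proof.
elim/ptree_mem_ind: t => s IH /=; congr Node.
apply/(perm_sortP leT_total leT_trans leT_anti).
apply: (@perm_trans _ (map canon (map canon s))).
  by apply: perm_map; rewrite perm_sort.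
rewrite -map_comp (_ : map _ s = map canon s) //.
by apply/eq_in_map => t ts; exact: IH.
Qed.

Record rtree := RTree { rval :> ptree; _ : canon rval == rval }.
HB.instance Definition _ := [isSub for rval].
HB.instance Definition _ := [Countable of rtree by <:].

Lemma canon_canon t : canon (canon t) == canon t.
Proof. by rewrite canonK. Qed.
Definition rclass (t : ptree) : rtree := RTree (canon_canon t).

Lemma rval_canon (T : rtree) : canon T = T. Proof. by case: T => t /= /eqP. Qed.
Lemma rclassK (T : rtree) : rclass T = T.
Proof. by apply: val_inj; rewrite /= rval_canon. Qed.
Lemma eq_rclass t u : (rclass t == rclass u) = (canon t == canon u).
Proof. by []. Qed.

Lemma tsize_canon t : tsize (canon t) = tsize t.
Proof.
elim/ptree_mem_ind: t => s IH /=; congr _.+1.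
rewrite (perm_sumn (_ : perm_eq _ (map tsize (map canon s)))); last first.
  by apply: perm_map; rewrite perm_sort.
by rewrite -map_comp; congr sumn; apply/eq_in_map => t ts /=; exact: IH.
Qed.

Definition nvert (T : rtree) : nat := tsize T.

Lemma nvert_gt0 T : (0 < nvert T)%N. Proof. by rewrite /nvert; case: T => [[s]]. Qed.
Lemma nvert_rclass t : nvert (rclass t) = tsize t.
Proof. exact: tsize_canon. Qed.

Definition bullet : rtree := rclass (Node [::]).

(* The list, indexed by the vertices v of t, of the trees obtained from t and u
   by adding an edge from the root of u to v. *)
Fixpoint graft (t u : ptree) {struct t} : seq ptree :=
  let: Node s := t in
  Node (u :: s) ::
  map Node ((fix graft_forest (s : seq ptree) : seq (seq ptree) :=
     if s is a :: s' then
       [seq b :: s' | b <- graft a u] ++ [seq a :: r | r <- graft_forest s']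
     else [::]) s).

Fixpoint graft_forest (s : seq ptree) (u : ptree) : seq (seq ptree) :=
  if s is a :: s' then
    [seq b :: s' | b <- graft a u] ++ [seq a :: r | r <- graft_forest s' u]
  else [::].

Lemma graft_Node s u : graft (Node s) u = Node (u :: s) :: map Node (graft_forest s u).
Proof. by congr (_ :: map _ _); elim: s => //= a s ->. Qed.

Lemma size_graft_forest_aux s u :
  {in s, forall t, size (graft t u) = tsize t} ->
  size (graft_forest s u) = sumn (map tsize s).
Proof.
elim: s => //= a s IHs IH; rewrite size_cat !size_map IH ?mem_head //.
by rewrite IHs // => t ts; apply: IH; rewrite inE ts orbT.
Qed.

Lemma size_graft t u : size (graft t u) = tsize t.
Proof.
elim/ptree_mem_ind: t => s IH; rewrite graft_Node /= size_map.
by rewrite size_graft_forest_aux.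
Qed.

Lemma tsize_graft t u g : g \in graft t u -> tsize g = (tsize t + tsize u)%N.
Proof.
elim/ptree_mem_ind: t g => s IH g; rewrite graft_Node inE => /orP[/eqP->|].
  by rewrite /= addSn addnC.
case/mapP => r rs ->{g} /=; rewrite addSn; congr _.+1.
elim: s IH r rs => //= a s IHs IH r; rewrite mem_cat => /orP[] /mapP[b bs ->] /=.
  by rewrite (IH a) ?mem_head // addnAC.
by rewrite (IHs _ b) ?addnA // => t ts; apply: IH; rewrite inE ts orbT.
Qed.

Section Invariance.
Variable V : nmodType.
Implicit Types (f : ptree -> V) (F : seq ptree -> V).

Definition tinv (f : ptree -> V) := forall t u, canon t = canon u -> f t = f u.
Definition finv (F : seq ptree -> V) :=
  forall r s, perm_eq (map canon r) (map canon s) -> F r = F s.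

Lemma tinv_finv f : tinv f -> finv (f \o Node).
Proof. by move=> fi r s rs; apply: fi; apply/eqP; rewrite canon_Node_eq. Qed.
Lemma finv_cons F a : finv F -> finv (F \o cons a).
Proof. by move=> Fi r s rs; apply: Fi; rewrite /= perm_cons. Qed.
Lemma finv_head F s : finv F -> tinv (fun b => F (b :: s)).
Proof. by move=> Fi t u tu; apply: Fi; rewrite /= tu. Qed.

Lemma big_graft f s u : \sum_(g <- graft (Node s) u) f g =
  f (Node (u :: s)) + \sum_(r <- graft_forest s u) f (Node r).
Proof. by rewrite graft_Node big_cons big_map. Qed.

Lemma big_graft_forest F a s u : \sum_(r <- graft_forest (a :: s) u) F r =
  \sum_(b <- graft a u) F (b :: s) + \sum_(r <- graft_forest s u) F (a :: r).
Proof. by rewrite /= big_cat /= !big_map. Qed.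

Lemma perm_eq_ind (E : eqType) (P : seq E -> seq E -> Prop) :
  P [::] [::] -> (forall x s t, P s t -> P (x :: s) (x :: t)) ->
  (forall x y s, P (x :: y :: s) (y :: x :: s)) ->
  (forall s t r, P s t -> P t r -> P s r) ->
  forall s t, perm_eq s t -> P s t.
Proof.
move=> P0 Pc Ps Pt.
have Pid s : P s s by elim: s => // x s; exact: Pc.
have Pm x s1 s2 : P (x :: s1 ++ s2) (s1 ++ x :: s2).
  elim: s1 => [|y s1 IH] /=; first exact: Pid.
  by apply: Pt (Ps _ _ _) _; exact: Pc.
elim=> [|x s IH] t; first by rewrite perm_sym => /perm_nilP->.
move=> p; have xt : x \in t by rewrite -(perm_mem p) mem_head.
move: p; case/splitPr: xt => t1 t2.
rewrite -[_ :: t2]cat1s perm_sym perm_catCA /= perm_cons perm_sym => p.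
exact: Pt (Pc _ _ _ (IH _ p)) (Pm _ _ _).
Qed.

Lemma graft_canon_r t f u v : tinv f -> canon u = canon v ->
  \sum_(g <- graft t u) f g = \sum_(g <- graft t v) f g.
Proof.
move=> fi uv; elim/ptree_mem_ind: t f fi => s IH f fi; rewrite !big_graft.
congr (_ + _); first by apply: fi; rewrite /= uv.
rewrite -[LHS]/(\sum_(r <- graft_forest s u) (f \o Node) r).
rewrite -[RHS]/(\sum_(r <- graft_forest s v) (f \o Node) r).
move: (f \o Node) (tinv_finv fi) => F {fi f}.
elim: s IH F => [|a s IHs] IH F Fi; first by rewrite !big_nil.
rewrite !big_graft_forest IH ?mem_head //; last exact: finv_head.
congr (_ + _); apply: (IHs _ (F \o cons a)); last exact: finv_cons.
by move=> t ts; apply: IH; rewrite inE ts orbT.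
Qed.

Lemma graft_forest_canon s F u :
  (forall a, a \in s -> forall f, tinv f ->
     \sum_(g <- graft a u) f g = \sum_(g <- graft (canon a) u) f g) ->
  finv F ->
  \sum_(r <- graft_forest s u) F r = \sum_(r <- graft_forest (map canon s) u) F r.
Proof.
elim: s F => [|a s IHs] F IH Fi; first by rewrite !big_nil.
rewrite [map _ _]/= !big_graft_forest IH ?mem_head //; last exact: finv_head.
congr (_ + _).
  apply: eq_bigr => b _; apply: Fi; rewrite /= perm_cons -map_comp.
  by rewrite (eq_map (g := canon)) // => t /=; rewrite canonK.
rewrite (IHs (F \o cons a)); [|by move=> t ts; apply: IH; rewrite inE ts orbT|exact: finv_cons].
by apply: eq_bigr => r _; apply: Fi; rewrite /= canonK.
Qed.

Lemma graft_forest_perm s s' F u : perm_eq s s' -> finv F ->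
  \sum_(r <- graft_forest s u) F r = \sum_(r <- graft_forest s' u) F r.
Proof.
move=> ss' Fi.
suff [_ H] : perm_eq s s' /\ (forall F, finv F ->
  \sum_(r <- graft_forest s u) F r = \sum_(r <- graft_forest s' u) F r) by exact: H.
move: s s' ss' => {F Fi}.
apply: perm_eq_ind => [|x s t [st IH]|x y s|s t r [st IH1] [tr IH2]].
- by [].
- split=> [|F Fi]; first by rewrite perm_cons.
  rewrite !big_graft_forest (IH (F \o cons x) (finv_cons x Fi)); congr (_ + _).
  by apply: eq_bigr => b _; apply: Fi; rewrite /= perm_cons perm_map.
- have sw a b r : perm_eq [:: a, b & r] [:: b, a & r].
    by rewrite -[[:: a, b & r]]/([:: a] ++ [:: b] ++ r) perm_catCA.
  split=> [|F Fi]; first exact: sw.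
  have Fsw a b r : F [:: a, b & r] = F [:: b, a & r].
    by apply: Fi; apply: perm_map; exact: sw.
  rewrite !big_graft_forest addrCA; congr (_ + _); last congr (_ + _).
  + by apply: eq_bigr => b _; exact: Fsw.
  + by apply: eq_bigr => b _; exact: Fsw.
  + by apply: eq_bigr => b _; exact: Fsw.
- by split=> [|F Fi]; [exact: perm_trans st tr | rewrite IH1 ?IH2].
Qed.

Lemma graft_canon_l t f u : tinv f ->
  \sum_(g <- graft t u) f g = \sum_(g <- graft (canon t) u) f g.
Proof.
elim/ptree_mem_ind: t f => s IH f fi; rewrite /= !big_graft.
have ps : perm_eq (map canon s) (sort leT (map canon s)) by rewrite perm_sym perm_sort.
congr (_ + _).
  apply: fi; apply/eqP; rewrite canon_Node_eq /= perm_cons.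
  apply: perm_trans (perm_map canon ps).
  by rewrite -map_comp (eq_map (g := canon)) // => t /=; rewrite canonK.
have Fi := tinv_finv fi.
rewrite -(graft_forest_perm _ ps Fi).
by apply: (@graft_forest_canon s (f \o Node)) => // a sa g gi; apply: IH.
Qed.

Lemma graft_canon t u f : tinv f ->
  \sum_(g <- graft t u) f g = \sum_(g <- graft (canon t) (canon u)) f g.
Proof.
move=> fi; rewrite graft_canon_l //; apply: graft_canon_r => //.
by rewrite canonK.
Qed.
End Invariance.

Section PreLieTrees.
Variable V : zmodType.
Implicit Types (f : ptree -> V) (F : seq ptree -> V).

Let D t u v f := \sum_(g <- graft t u) \sum_(h <- graft g v) f h
  - \sum_(k <- graft u v) \sum_(h <- graft t k) f h.
Let DF s u v F := \sum_(r <- graft_forest s u) \sum_(h <- graft_forest r v) F h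
  - \sum_(k <- graft u v) \sum_(h <- graft_forest s k) F h.

Let D_Node s u v f : D (Node s) u v f = f (Node [:: v, u & s])
  + (\sum_(r <- graft_forest s v) f (Node (u :: r))
     + \sum_(r <- graft_forest s u) f (Node (v :: r))) + DF s u v (f \o Node).
Proof.
rewrite /D big_graft big_graft big_graft_forest.
under [X in _ + X - _]eq_bigr => r _ do rewrite big_graft.
under [X in _ - X]eq_bigr => k _ do rewrite big_graft.
rewrite !big_split /= /DF /=.
have gen (a b c d e g : V) : a + (b + c) + (d + e) - (b + g) = a + (c + d) + (e - g).
  apply/eqP; rewrite subr_eq -{1}[e](subrK g); apply/eqP; move: (e - g) => h.
  by rewrite (AC ((1*2)*(1*2)) (((1*(3*4))*5)*(2*6))).
exact: gen.
Qed.

Let DF_cons a s u v F : DF (a :: s) u v F = D a u v (fun b => F (b :: s))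
  + (\sum_(b <- graft a u) \sum_(r <- graft_forest s v) F (b :: r)
     + \sum_(r <- graft_forest s u) \sum_(b <- graft a v) F (b :: r))
  + DF s u v (F \o cons a).
Proof.
rewrite /DF big_graft_forest.
under eq_bigr => b _ do rewrite big_graft_forest.
under [X in _ + X - _]eq_bigr => b _ do rewrite big_graft_forest.
under [X in _ - X]eq_bigr => b _ do rewrite big_graft_forest.
rewrite !big_split /= /D.
have gen (x b c d e g : V) : x + b + (c + d) - (e + g) = x - e + (b + c) + (d - g).
  by rewrite opprD (AC ((2*2)*2) (((1*5)*(2*3))*(4*6))).
exact: gen.
Qed.

Lemma graft_preLie t u v f : tinv f ->
  \sum_(g <- graft t u) \sum_(h <- graft g v) f h
    - \sum_(k <- graft u v) \sum_(h <- graft t k) f h =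
  \sum_(g <- graft t v) \sum_(h <- graft g u) f h
    - \sum_(k <- graft v u) \sum_(h <- graft t k) f h.
Proof.
rewrite -/(D t u v f) -/(D t v u f).
elim/ptree_mem_ind: t f => s IH f fi; rewrite !D_Node; congr (_ + _ + _).
- apply: fi; apply/eqP; rewrite canon_Node_eq; apply: perm_map.
  by rewrite -[[:: v, u & s]]/([:: v] ++ [:: u] ++ s) perm_catCA.
- exact: addrC.
move: (f \o Node) (tinv_finv fi) => F Fi.
elim: s IH F Fi => [|a s IHs] IH F Fi.
  by rewrite /DF /= !big_nil !big1 // => k _; rewrite big_nil.
rewrite !DF_cons IH ?mem_head //; last exact: finv_head.
congr (_ + _ + _); last first.
  apply: IHs; last exact: finv_cons.
  by move=> t ts; apply: IH; rewrite inE ts orbT.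
by rewrite addrC; congr (_ + _); rewrite exchange_big.
Qed.
End PreLieTrees.

Lemma nvert_bullet : nvert bullet = 1%N. Proof. by rewrite nvert_rclass. Qed.

Lemma nvert1 T : nvert T = 1%N -> T = bullet.
Proof.
move=> T1; rewrite -(rclassK T); congr rclass.
by case: T T1 => -[[|[r] s]] //= _ /eqP.
Qed.

(* The trees with n vertices: those with n.+1 vertices are obtained by grafting
   a leaf on a tree with n vertices (mem_trees, trees_uniq). *)
Fixpoint trees (n : nat) : seq rtree :=
  match n with
  | 0 => [::]
  | 1 => [:: bullet]
  | m.+1 => undup [seq rclass g | A : rtree <- trees m, g <- graft A (Node [::])]
  end.

Lemma graft_leaf t : (1 < tsize t)%N -> exists t', t \in graft t' (Node [::]).
Proof.
elim/ptree_mem_ind: t => -[//|a s] IH _.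
have [|a1] := boolP (1 < tsize a)%N.
  move/(IH _ (mem_head _ _)) => [a' aa']; exists (Node (a' :: s)).
  rewrite graft_Node inE; apply/orP; right; apply: map_f.
  by rewrite /= mem_cat map_f.
exists (Node s); rewrite graft_Node inE; apply/orP; left; apply/eqP.
by case: a a1 {IH} => -[|[r] s'].
Qed.

Lemma mem_graft_canon t u g : g \in graft t u ->
  exists2 h, h \in graft (canon t) (canon u) & canon h = canon g.
Proof.
move=> gt; pose f h := (canon h == canon g : nat).
have fi : tinv (V := nat) f by move=> a b ab; rewrite /f ab.
have := graft_canon t u fi; rewrite (big_rem _ gt) /= {1}/f eqxx => /esym e.
have /hasP[h hh hg] : has (fun h => canon h == canon g) (graft (canon t) (canon u)).
  apply/negPn/negP => /hasPn no; move: e; rewrite big_seq big1 //.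
  by move=> h hh; rewrite /f (negPf (no _ hh)).
by exists h => //; exact/eqP.
Qed.

Lemma mem_trees T n : (T \in trees n) = (nvert T == n).
Proof.
elim: n T => [|[|n] IH] T; first by rewrite gtn_eqF // nvert_gt0.
  by rewrite inE; apply/eqP/eqP => [->|/nvert1]; rewrite ?nvert_bullet.
rewrite -[trees n.+2]/(undup _) mem_undup; apply/flatten_mapP/eqP.
  case=> A; rewrite IH => /eqP An /mapP[g gA ->].
  by rewrite nvert_rclass (tsize_graft gA) -/(nvert A) An addn1.
move=> Tn; have [|t' Tt'] := @graft_leaf T; first by rewrite -/(nvert T) Tn.
have [h hh hT] := mem_graft_canon Tt'.
exists (rclass t'); last first.
  apply/mapP; exists h => //; apply: val_inj => /=; rewrite hT rval_canon //.
rewrite IH nvert_rclass; have := tsize_graft Tt'; rewrite -/(nvert T) Tn /= addn1.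
by case=> <-.
Qed.

Lemma trees_uniq n : uniq (trees n).
Proof. by case: n => [|[|n]] //; rewrite -[trees n.+2]/(undup _) undup_uniq. Qed.

Definition trees_lt (n : nat) : seq rtree := flatten [seq trees k | k <- iota 0 n].

Lemma mem_trees_lt T n : (T \in trees_lt n) = (nvert T < n)%N.
Proof.
apply/flatten_mapP/idP => [[k]|Tn].
  by rewrite mem_iota mem_trees => /= kn /eqP->.
by exists (nvert T); rewrite ?mem_iota ?mem_trees.
Qed.

Lemma trees_lt_uniq n : uniq (trees_lt n).
Proof.
rewrite /trees_lt; elim: n => // n IH.
rewrite -addn1 iotaD map_cat flatten_cat cat_uniq IH /= cats0 trees_uniq andbT.
apply/hasPn => T; rewrite mem_trees => /eqP Tn.
by rewrite -/(trees_lt n) mem_trees_lt -leqNgt Tn.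
Qed.

Definition gcount (A B S : rtree) : nat := count (fun g => rclass g == S) (graft A B).

Lemma gcount_deg A B S : nvert S != (nvert A + nvert B)%N -> gcount A B S = 0%N.
Proof.
move=> d; apply/eqP; rewrite -leqn0 leqNgt -has_count; apply/hasPn => g gAB.
apply: contraNN d => /eqP<-; rewrite nvert_rclass; exact/eqP/tsize_graft.
Qed.

(* As there are finitely many trees with n vertices, the completion
   \prod_n PL_n is the space of all functions from trees to K: x S is the
   coefficient of S in x. *)
Definition PLhat (K : Type) := rtree -> K.

Definition wdeg (w : seq rtree) : nat := sumn (map nvert w).

Lemma wdeg_cat v w : wdeg (v ++ w) = (wdeg v + wdeg w)%N.
Proof. by rewrite /wdeg map_cat sumn_cat. Qed.

Lemma size_wdeg w : (size w <= wdeg w)%N.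
Proof. by elim: w => //= T w IH; rewrite /wdeg /= -add1n leq_add ?nvert_gt0. Qed.

Fixpoint words_len (L : seq rtree) (k : nat) : seq (seq rtree) :=
  if k is k'.+1 then [seq T :: w | T <- L, w <- words_len L k'] else [:: [::]].

(* The words of total degree < n (mem_words_lt, words_lt_uniq). *)
Definition words_lt (n : nat) : seq (seq rtree) :=
  [seq w <- flatten [seq words_len (trees_lt n) k | k <- iota 0 n] | (wdeg w < n)%N].

Lemma mem_words_len L k w : (w \in words_len L k) = (size w == k) && all (mem L) w.
Proof.
elim: k w => [|k IH] [|T w] //=.
  by apply/allpairsP => -[[? ?] []].
apply/allpairsP/idP => [[[T' w'] /= [TL]]|/and3P[sk TL wL]].
  by rewrite IH => /andP[sk aw] [-> ->]; rewrite eqSS sk TL.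
by exists (T, w); rewrite /= IH; split => //; apply/andP.
Qed.

Lemma words_len_uniq L k : uniq L -> uniq (words_len L k).
Proof.
move=> uL; elim: k => //= k IH; apply: allpairs_uniq => //.
by move=> [a b] [c d] _ _ /= [-> ->].
Qed.

Lemma mem_words_lt n w : (w \in words_lt n) = (wdeg w < n)%N.
Proof.
rewrite mem_filter; have [wn|//] := boolP (wdeg w < n)%N.
rewrite /=; apply/flatten_mapP; exists (size w).
  by rewrite mem_iota /= (leq_ltn_trans (size_wdeg w)).
rewrite mem_words_len eqxx; apply/allP => T Tw; rewrite /= mem_trees_lt.
apply: leq_ltn_trans wn; rewrite /wdeg.
by elim: w Tw => //= a w IH; rewrite inE => /orP[/eqP->|/IH h]; rewrite ?leq_addr // (leq_trans h) // leq_addl.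
Qed.

Lemma words_lt_uniq n : uniq (words_lt n).
Proof.
apply: filter_uniq; move: (trees_lt n) (trees_lt_uniq n) => L uL.
elim: n => // n IH; rewrite -addn1 iotaD map_cat flatten_cat cat_uniq IH /= cats0.
rewrite words_len_uniq // andbT; apply/hasPn => w; rewrite mem_words_len => /andP[/eqP sw _].
apply/flatten_mapP => -[k]; rewrite mem_iota /= mem_words_len => kn /andP[/eqP sk _].
by move: kn; rewrite -sk sw add0n ltnn.
Qed.

Section Algebra.
Variable K : fieldType.
Local Notation PL := (PLhat K).
Local Notation TT := (seq rtree -> K).

(* The pre-Lie product: only trees with fewer vertices than S contribute to the
   coefficient of S (prelieE). *)
Definition prelie (x y : PL) : PL := fun S =>
  \sum_(A <- trees_lt (nvert S)) \sum_(B <- trees_lt (nvert S))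
    x A * y B * (gcount A B S)%:R.

Definition basis (T : rtree) : PL := fun S => (S == T)%:R.

Lemma big_uniq_widen (I : eqType) (r r' : seq I) (F : I -> K) :
  uniq r -> uniq r' -> {subset r <= r'} ->
  (forall i, i \in r' -> i \notin r -> F i = 0) ->
  \sum_(i <- r') F i = \sum_(i <- r) F i.
Proof.
move=> ur ur' rr' F0; rewrite (bigID (mem r)) /= [X in _ + X]big_seq_cond.
rewrite [X in _ + X]big1 ?addr0; last by move=> i /andP[/F0]; exact.
rewrite -big_filter; apply: perm_big; apply: uniq_perm => //; first exact: filter_uniq.
by move=> i; rewrite mem_filter /=; apply/andP/idP => [[]//|ir]; split=> //; exact: rr'.
Qed.

Lemma trees_widen m n (F : rtree -> K) : (m <= n)%N ->
  (forall T, (m <= nvert T)%N -> F T = 0) ->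
  \sum_(T <- trees_lt n) F T = \sum_(T <- trees_lt m) F T.
Proof.
move=> mn F0; apply: big_uniq_widen => [|||T _]; rewrite ?trees_lt_uniq //.
  by move=> T; rewrite !mem_trees_lt => /leq_trans; exact.
by rewrite mem_trees_lt -leqNgt => /F0.
Qed.

Lemma words_widen m n (F : seq rtree -> K) : (m <= n)%N ->
  (forall w, (m <= wdeg w)%N -> F w = 0) ->
  \sum_(w <- words_lt n) F w = \sum_(w <- words_lt m) F w.
Proof.
move=> mn F0; apply: big_uniq_widen => [|||w _]; rewrite ?words_lt_uniq //.
  by move=> T; rewrite !mem_words_lt => /leq_trans; exact.
by rewrite mem_words_lt -leqNgt => /F0.
Qed.

Lemma sum_pick (I : eqType) (r : seq I) (i : I) (F : I -> K) : uniq r ->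
  \sum_(j <- r) (i == j)%:R * F j = if i \in r then F i else 0.
Proof.
move=> ur; case: ifP => ir.
  rewrite (bigD1_seq i) //= eqxx mul1r big1 ?addr0 // => j /negPf.
  by rewrite eq_sym => ->; rewrite mul0r.
rewrite big_seq big1 // => j jr; case: eqP => [e|]; last by rewrite mul0r.
by rewrite e jr in ir.
Qed.

Lemma prelieE n x y S : (nvert S <= n)%N -> prelie x y S =
  \sum_(A <- trees_lt n) \sum_(B <- trees_lt n) x A * y B * (gcount A B S)%:R.
Proof.
move=> Sn; rewrite /prelie -(trees_widen Sn).
  apply: eq_bigr => A _; rewrite -(trees_widen Sn) // => B SB.
  by rewrite gcount_deg ?mulr0 // ltn_eqF // (leq_ltn_trans SB) // -{1}[nvert B]add0n ltn_add2r nvert_gt0.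
move=> A SA; rewrite big1 // => B _.
by rewrite gcount_deg ?mulr0 // ltn_eqF // (leq_ltn_trans SA) // -{1}[nvert A]addn0 ltn_add2l nvert_gt0.
Qed.

Lemma gcountE A B S : (gcount A B S)%:R = \sum_(g <- graft A B) (rclass g == S)%:R :> K.
Proof.
rewrite /gcount -sum1_count natr_sum big_mkcond.
by apply: eq_bigr => g _; case: (_ == _).
Qed.

Lemma tinv_class (f : rtree -> K) : tinv (f \o rclass).
Proof. by move=> t u tu /=; congr f; apply/eqP; rewrite eq_rclass tu. Qed.

Lemma sum_gcount n A B (F : rtree -> K) :
  (forall P, (n <= nvert P)%N -> F P = 0) ->
  \sum_(P <- trees_lt n) (gcount A B P)%:R * F P = \sum_(g <- graft A B) F (rclass g).
Proof.
move=> F0; under eq_bigr => P _ do rewrite gcountE mulr_suml.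
rewrite exchange_big /=; apply: eq_bigr => g _.
rewrite sum_pick ?trees_lt_uniq // mem_trees_lt; case: ltnP => // /F0 //.
Qed.

Lemma gcount_big A B n S : (nvert S <= n)%N -> (n <= nvert A)%N || (n <= nvert B)%N ->
  gcount A B S = 0%N.
Proof.
move=> Sn h; apply: gcount_deg; rewrite ltn_eqF //; apply: leq_ltn_trans Sn _.
case/orP: h => h; apply: leq_ltn_trans h _.
  by rewrite -{1}[nvert A]addn0 ltn_add2l nvert_gt0.
by rewrite -{1}[nvert B]add0n ltn_add2r nvert_gt0.
Qed.

Lemma prelie_assocl n x y z S : (nvert S <= n)%N -> prelie (prelie x y) z S =
  \sum_(A <- trees_lt n) \sum_(B <- trees_lt n) \sum_(C <- trees_lt n)
    x A * y B * z C *
    (\sum_(g <- graft A B) \sum_(h <- graft g C) (rclass h == S)%:R).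
Proof.
move=> Sn; rewrite (prelieE _ _ Sn).
transitivity (\sum_(P <- trees_lt n) \sum_(C <- trees_lt n)
   \sum_(A <- trees_lt n) \sum_(B <- trees_lt n)
   x A * y B * z C * ((gcount A B P)%:R * (gcount P C S)%:R)).
  rewrite big_seq [RHS]big_seq; apply: eq_bigr => P.
  rewrite mem_trees_lt => /ltnW Pn; apply: eq_bigr => C _.
  rewrite (prelieE _ _ Pn) !mulr_suml; apply: eq_bigr => A _.
  rewrite !mulr_suml; apply: eq_bigr => B _.
  by rewrite -!mulrA; congr (_ * (_ * _)); rewrite mulrCA.
under eq_bigr => P _ do rewrite exchange_big /=.
rewrite exchange_big; apply: eq_bigr => A _ /=.
under eq_bigr => P _ do rewrite exchange_big /=.
rewrite exchange_big; apply: eq_bigr => B _ /=.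
rewrite exchange_big; apply: eq_bigr => C _ /=.
rewrite -mulr_sumr sum_gcount.
  congr (_ * _); apply: eq_bigr => g _; rewrite gcountE.
  by rewrite [RHS](graft_canon _ _ (tinv_class (fun P => (P == S)%:R))) rval_canon.
by move=> P nP; rewrite (gcount_big Sn) ?nP.
Qed.

Lemma prelie_assocr n x y z S : (nvert S <= n)%N -> prelie x (prelie y z) S =
  \sum_(A <- trees_lt n) \sum_(B <- trees_lt n) \sum_(C <- trees_lt n)
    x A * y B * z C *
    (\sum_(k <- graft B C) \sum_(h <- graft A k) (rclass h == S)%:R).
Proof.
move=> Sn; rewrite (prelieE _ _ Sn); apply: eq_bigr => A _.
transitivity (\sum_(P <- trees_lt n) 
   \sum_(B <- trees_lt n) \sum_(C <- trees_lt n)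
   x A * y B * z C * ((gcount B C P)%:R * (gcount A P S)%:R)).
  rewrite big_seq [RHS]big_seq; apply: eq_bigr => P.
  rewrite mem_trees_lt => /ltnW Pn.
  rewrite (prelieE _ _ Pn) mulr_sumr mulr_suml; apply: eq_bigr => B _.
  rewrite mulr_sumr mulr_suml; apply: eq_bigr => C _.
  by rewrite -!mulrA.
rewrite exchange_big; apply: eq_bigr => B _ /=.
rewrite exchange_big; apply: eq_bigr => C _ /=.
rewrite -mulr_sumr sum_gcount.
  congr (_ * _); apply: eq_bigr => g _; rewrite gcountE.
  by rewrite [RHS](graft_canon _ _ (tinv_class (fun P => (P == S)%:R))) rval_canon.
by move=> P nP; rewrite (gcount_big Sn) ?nP ?orbT.
Qed.

Lemma prelie_pre_lie x y z :
  prelie (prelie x y) z - prelie x (prelie y z) =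
  prelie (prelie x z) y - prelie x (prelie z y).
Proof.
apply/funext => S; rewrite -[LHS]/(_ S - _ S) -[RHS]/(_ S - _ S).
rewrite !(prelie_assocl _ _ _ (leqnn _)) !(prelie_assocr _ _ _ (leqnn _)).
rewrite -!sumrB; apply: eq_bigr => A _; rewrite -!sumrB.
under eq_bigr => B _ do rewrite -sumrB.
under [RHS]eq_bigr => B _ do rewrite -sumrB.
rewrite [RHS]exchange_big; apply: eq_bigr => B _; apply: eq_bigr => C _ /=.
rewrite -!mulrBr [x A * z C * _]mulrAC; congr (_ * _).
exact: (graft_preLie _ _ _ (tinv_class (fun P => (P == S)%:R))).
Qed.

Lemma prelieDl x x' y : prelie (x + x') y = prelie x y + prelie x' y.
Proof.
apply/funext => S; rewrite -[RHS]/(_ S + _ S) /prelie -big_split; apply: eq_bigr => A _.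
by rewrite -big_split; apply: eq_bigr => B _; rewrite /= -mulrDl -mulrDl.
Qed.
Lemma prelieDr x y y' : prelie x (y + y') = prelie x y + prelie x y'.
Proof.
apply/funext => S; rewrite -[RHS]/(_ S + _ S) /prelie -big_split; apply: eq_bigr => A _.
by rewrite -big_split; apply: eq_bigr => B _; rewrite /= -mulrDl -mulrDr.
Qed.
Lemma prelieNl x y : prelie (- x) y = - prelie x y.
Proof.
apply/funext => S; rewrite -[RHS]/(- _ S) /prelie -sumrN; apply: eq_bigr => A _.
by rewrite -sumrN; apply: eq_bigr => B _; rewrite -!mulNr.
Qed.
Lemma prelieNr x y : prelie x (- y) = - prelie x y.
Proof.
apply/funext => S; rewrite -[RHS]/(- _ S) /prelie -sumrN; apply: eq_bigr => A _.
by rewrite -sumrN; apply: eq_bigr => B _; rewrite -mulNr -mulrN.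
Qed.
Lemma prelieBl x x' y : prelie (x - x') y = prelie x y - prelie x' y.
Proof. by rewrite prelieDl prelieNl. Qed.
Lemma prelieBr x y y' : prelie x (y - y') = prelie x y - prelie x y'.
Proof. by rewrite prelieDr prelieNr. Qed.
Lemma prelie0l y : prelie 0 y = 0.
Proof. by have := prelieBl 0 0 y; rewrite !subrr. Qed.

Lemma prelie_local n x x' y y' S : (nvert S <= n)%N ->
  (forall T, (nvert T < n)%N -> x T = x' T) ->
  (forall T, (nvert T < n)%N -> y T = y' T) -> prelie x y S = prelie x' y' S.
Proof.
move=> Sn xx' yy'; rewrite !(prelieE _ _ Sn).
rewrite big_seq [RHS]big_seq; apply: eq_bigr => A; rewrite mem_trees_lt => /xx' ->.
by rewrite big_seq [RHS]big_seq; apply: eq_bigr => B; rewrite mem_trees_lt => /yy' ->.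
Qed.

Lemma prelie_low n m x y : (forall T, (nvert T < n)%N -> x T = 0) ->
  (forall T, (nvert T < m)%N -> y T = 0) ->
  forall S, (nvert S < n + m)%N -> prelie x y S = 0.
Proof.
move=> x0 y0 S Sn; rewrite /prelie big1 // => A _; rewrite big1 // => B _.
have [/x0->|nA] := ltnP (nvert A) n; first by rewrite !mul0r.
have [/y0->|mB] := ltnP (nvert B) m; first by rewrite mulr0 mul0r.
by rewrite gcount_deg ?mulr0 // ltn_eqF // (leq_trans Sn) // leq_add.
Qed.

Lemma basis_low T S : (nvert S < nvert T)%N -> basis T S = 0.
Proof. by rewrite /basis; case: eqP => // ->; rewrite ltnn. Qed.

Definition actw (x : PL) (w : seq rtree) : PL :=
  foldl (fun y T => prelie y (basis T)) x w.

Lemma actw_cat x v w : actw x (v ++ w) = actw (actw x v) w.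
Proof. exact: foldl_cat. Qed.

Lemma actw_low n x w : (forall T, (nvert T < n)%N -> x T = 0) ->
  forall S, (nvert S < n + wdeg w)%N -> actw x w S = 0.
Proof.
elim: w n x => [|T w IH] n x x0 S; first by rewrite addn0; exact: x0.
rewrite /wdeg /= addnA; apply: IH => S' S'n.
by apply: prelie_low S'n => // ?; exact: basis_low.
Qed.

Lemma actw0 x w S : (nvert S <= wdeg w)%N -> actw x w S = 0.
Proof.
move=> Sw; apply: (@actw_low 1); last by rewrite add1n ltnS.
by move=> T; rewrite ltnS leqn0 => /eqP T0; have := nvert_gt0 T; rewrite T0.
Qed.

(* The right action on PL^ of the completed tensor algebra of PL, whose elements
   are the formal series in words of trees: w = T1 ... Tk acts by
   x |-> (... (x <| T1) <| ...) <| Tk.  Words of degree at least nvert S do not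
   contribute to the coefficient of S (actw0). *)
Definition tact (x : PL) (u : TT) : PL := fun S =>
  \sum_(w <- words_lt (nvert S)) u w * actw x w S.

Lemma tactE n x u S : (nvert S <= n)%N ->
  tact x u S = \sum_(w <- words_lt n) u w * actw x w S.
Proof.
by move=> Sn; rewrite /tact -(words_widen Sn) // => w /actw0 ->; rewrite mulr0.
Qed.

Lemma prelie_sum (I : Type) (r : seq I) (c : I -> K) (X : I -> PL) y :
  prelie (fun S => \sum_(i <- r) c i * X i S) y =
  fun S => \sum_(i <- r) c i * prelie (X i) y S.
Proof.
apply/funext => S; rewrite /prelie.
under [RHS]eq_bigr => i _ do rewrite mulr_sumr.
rewrite [RHS]exchange_big; apply: eq_bigr => A _ /=.
under [RHS]eq_bigr => i _ do rewrite mulr_sumr.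
rewrite [RHS]exchange_big; apply: eq_bigr => B _ /=.
by rewrite !mulr_suml; apply: eq_bigr => i _; rewrite !mulrA.
Qed.

Lemma actw_sum (I : Type) (r : seq I) (c : I -> K) (X : I -> PL) w :
  actw (fun S => \sum_(i <- r) c i * X i S) w =
  fun S => \sum_(i <- r) c i * actw (X i) w S.
Proof. by elim: w X => //= T w IH X; rewrite prelie_sum IH. Qed.

Lemma actw_local n x x' w S : (nvert S <= n)%N ->
  (forall T, (nvert T <= n)%N -> x T = x' T) -> actw x w S = actw x' w S.
Proof.
elim: w x x' S => [|T w IH] x x' S Sn xx' /=; first exact: xx'.
apply: IH => // S' S'n; apply: (prelie_local S'n) => // T' /ltnW; exact: xx'.
Qed.

Lemma actw_tact x u w n S : (nvert S <= n)%N ->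
  actw (tact x u) w S = \sum_(v <- words_lt n) u v * actw (actw x v) w S.
Proof.
move=> Sn.
rewrite (@actw_local n _ (fun S => \sum_(v <- words_lt n) u v * actw x v S)) //.
  by rewrite actw_sum.
by move=> T Tn; rewrite (tactE _ _ Tn).
Qed.

Definition Tmul (u v : TT) : TT := fun w =>
  \sum_(i < (size w).+1) u (take i w) * v (drop i w).
Definition Tword (v : seq rtree) : TT := fun w => (w == v)%:R.
Definition Tin (x : PL) : TT := fun w => if w is [:: T] then x T else 0.

Lemma sum_splits (w : seq rtree) (n : nat) (G : seq rtree -> seq rtree -> K) :
  (wdeg w < n)%N ->
  \sum_(i < (size w).+1) G (take i w) (drop i w) =
  \sum_(v1 <- words_lt n) \sum_(v2 <- words_lt n) (v1 ++ v2 == w)%:R * G v1 v2.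
Proof.
move=> wn.
transitivity (\sum_(p <- [seq (v1, v2) | v1 <- words_lt n, v2 <- words_lt n])
  (p.1 ++ p.2 == w)%:R * G p.1 p.2); last by rewrite big_allpairs.
rewrite [RHS](eq_bigr (fun p => if p.1 ++ p.2 == w then G p.1 p.2 else 0)); last first.
  by move=> p _; case: eqP; rewrite ?mul1r ?mul0r.
rewrite -big_mkcond -big_filter.
rewrite -(big_mkord xpredT (fun i => G (take i w) (drop i w))).
rewrite -(big_map (fun i => (take i w, drop i w)) xpredT (fun p => G p.1 p.2)).
apply: perm_big; apply: uniq_perm.
- rewrite map_inj_in_uniq ?iota_uniq // => i j; rewrite !mem_index_iota /= !ltnS.
  move=> iw jw [/(congr1 size)]; rewrite !size_takel //.
- apply: filter_uniq; apply: allpairs_uniq; rewrite ?words_lt_uniq //.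
  by move=> [a b] [c d].
- move=> [v1 v2]; rewrite mem_filter; apply/mapP/andP => [[i _ [-> ->]]|[/eqP <- _]].
    rewrite cat_take_drop eqxx; split=> //; apply/allpairsP.
    exists (take i w, drop i w); rewrite !mem_words_lt; move: wn.
    rewrite -{1}(cat_take_drop i w) wdeg_cat => wn; split=> //=.
      exact: leq_ltn_trans (leq_addr _ _) wn.
    exact: leq_ltn_trans (leq_addl _ _) wn.
  exists (size v1); first by rewrite mem_index_iota /= ltnS size_cat leq_addr.
  by rewrite take_size_cat // drop_size_cat.
Qed.

Lemma tact_mul x u v : tact x (Tmul u v) = tact (tact x u) v.
Proof.
apply/funext => S; rewrite /tact; set n := nvert S.
under [RHS]eq_bigr => w _ do rewrite (actw_tact _ _ _ (leqnn _)) mulr_sumr.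
rewrite [RHS]exchange_big /=.
transitivity (\sum_(w <- words_lt n) \sum_(v1 <- words_lt n) \sum_(v2 <- words_lt n)
  (v1 ++ v2 == w)%:R * (u v1 * v v2 * actw x w S)).
  rewrite big_seq [RHS]big_seq; apply: eq_bigr => w; rewrite mem_words_lt => wn.
  by rewrite /Tmul mulr_suml (sum_splits (fun v1 v2 => u v1 * v v2 * actw x w S) wn).
rewrite exchange_big /=; apply: eq_bigr => v1 _.
rewrite exchange_big /=; apply: eq_bigr => v2 _.
rewrite sum_pick ?words_lt_uniq // mem_words_lt actw_cat; case: ltnP => [_|h].
  by rewrite -mulrA mulrCA.
by rewrite -actw_cat actw0 // !mulr0.
Qed.
End Algebra.

Arguments prelie {K} x y.

Section Algebra2.
Variable K : fieldType.
Local Notation PL := (PLhat K).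
Local Notation TT := (seq rtree -> K).
Implicit Types (x y z : PL) (u v t : TT).

Definition bracket x y : PL := prelie x y - prelie y x.

(* a (T T' - T' T - [T, T']) b, in the tensor algebra of PL *)
Definition lie_gen (a : seq rtree) (T T' : rtree) (b : seq rtree) : TT :=
  Tmul (Tword K a) (Tmul
    (Tmul (Tin (basis K T)) (Tin (basis K T')) - Tmul (Tin (basis K T')) (Tin (basis K T))
     - Tin (bracket (basis K T) (basis K T'))) (Tword K b)).

(* The two-sided ideal of the tensor algebra T(PL) (finite linear combinations
   only) such that U(PL) = T(PL) / lie_ideal. *)
Inductive lie_ideal : TT -> Prop :=
| lie_ideal_gen a T T' b : lie_ideal (lie_gen a T T' b)
| lie_ideal0 : lie_ideal 0
| lie_idealD u v : lie_ideal u -> lie_ideal v -> lie_ideal (u + v)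
| lie_idealZ c u : lie_ideal u -> lie_ideal (c \*o u).

Definition Tcomp (n : nat) u : TT := fun w => (wdeg w == n)%:R * u w.

Lemma TcompD n u v : Tcomp n (u + v) = Tcomp n u + Tcomp n v.
Proof. by apply/funext => w; rewrite /Tcomp -[RHS]/(_ * _ + _ * _) -mulrDr. Qed.
Lemma Tcomp0 n : Tcomp n (0 : TT) = 0.
Proof. by apply/funext => w; rewrite /Tcomp mulr0. Qed.
Lemma TcompN n u : Tcomp n (- u) = -1 \*o Tcomp n u.
Proof. by apply/funext => w; rewrite /Tcomp /= mulN1r -mulrN. Qed.

(* The degree completion of U(PL) is the product over n of
   T(PL)_n / (lie_ideal in degree n), i.e., the quotient of the completed tensor
   algebra by the series all of whose homogeneous components are in
   lie_ideal. *)
Definition Uker : {pred TT} := fun u => `[< forall n, lie_ideal (Tcomp n u) >].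

Lemma UkerP u : reflect (forall n, lie_ideal (Tcomp n u)) (u \in Uker).
Proof. exact: asboolP. Qed.

Lemma Uker_zmod : zmod_closed Uker.
Proof.
split=> [|u v /UkerP u0 /UkerP v0]; apply/UkerP => n.
  by rewrite Tcomp0; exact: lie_ideal0.
rewrite TcompD TcompN; apply: lie_idealD => //; exact: lie_idealZ.
Qed.
HB.instance Definition _ := GRing.isZmodClosed.Build TT Uker Uker_zmod.

Lemma TmulDl u v t : Tmul (u + v) t = Tmul u t + Tmul v t.
Proof.
apply/funext => w; rewrite -[RHS]/(Tmul u t w + Tmul v t w) /Tmul -big_split.
by apply: eq_bigr => i _; rewrite /= -mulrDl.
Qed.
Lemma TmulDr t u v : Tmul t (u + v) = Tmul t u + Tmul t v.
Proof.
apply/funext => w; rewrite -[RHS]/(Tmul t u w + Tmul t v w) /Tmul -big_split.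
by apply: eq_bigr => i _; rewrite /= -mulrDr.
Qed.
Lemma TmulZl c u v : Tmul (c \*o u) v = c \*o Tmul u v.
Proof.
by apply/funext => w; rewrite /= /Tmul mulr_sumr; apply: eq_bigr => i _; rewrite mulrA.
Qed.
Lemma TmulZr c u v : Tmul u (c \*o v) = c \*o Tmul u v.
Proof.
by apply/funext => w; rewrite /= /Tmul mulr_sumr; apply: eq_bigr => i _; rewrite mulrCA.
Qed.
Lemma Tmul0l u : Tmul 0 u = 0.
Proof. by apply/funext => w; rewrite /Tmul big1 // => i _; rewrite mul0r. Qed.
Lemma Tmul0r u : Tmul u 0 = 0.
Proof. by apply/funext => w; rewrite /Tmul big1 // => i _; rewrite mulr0. Qed.
Lemma TmulNl u v : Tmul (- u) v = - Tmul u v.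
Proof. by apply/eqP; rewrite -addr_eq0 -TmulDl addNr Tmul0l. Qed.
Lemma TmulNr u v : Tmul u (- v) = - Tmul u v.
Proof. by apply/eqP; rewrite -addr_eq0 -TmulDr addNr Tmul0r. Qed.
Lemma TmulBl u v t : Tmul (u - v) t = Tmul u t - Tmul v t.
Proof. by rewrite TmulDl TmulNl. Qed.
Lemma TmulBr t u v : Tmul t (u - v) = Tmul t u - Tmul t v.
Proof. by rewrite TmulDr TmulNr. Qed.

Lemma Tmul_wide u v w n : (wdeg w < n)%N -> Tmul u v w =
  \sum_(v1 <- words_lt n) \sum_(v2 <- words_lt n) (v1 ++ v2 == w)%:R * (u v1 * v v2).
Proof. by move=> wn; rewrite /Tmul (sum_splits (fun a b => u a * v b) wn). Qed.

Lemma TmulA u v t : Tmul u (Tmul v t) = Tmul (Tmul u v) t.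
Proof.
apply/funext => w; have wn := ltnSn (wdeg w); set n := _.+1 in wn.
pose X := \sum_(a <- words_lt n) \sum_(b <- words_lt n) \sum_(c <- words_lt n)
  (a ++ b ++ c == w)%:R * (u a * v b * t c).
have nil0 (m : nat) (F : seq rtree) c : F ++ c = w \/ c ++ F = w -> (wdeg F < n)%N.
  by move=> h; apply: leq_ltn_trans wn; case: h => <-; rewrite wdeg_cat ?leq_addr ?leq_addl.
transitivity X.
  rewrite (Tmul_wide _ _ wn); apply: eq_bigr => a _.
  transitivity (\sum_(d <- words_lt n) \sum_(b <- words_lt n) \sum_(c <- words_lt n)
      (b ++ c == d)%:R * ((a ++ d == w)%:R * (u a * v b * t c))).
    rewrite big_seq [RHS]big_seq; apply: eq_bigr => d; rewrite mem_words_lt => dn.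
    rewrite (Tmul_wide _ _ dn) !mulr_sumr; apply: eq_bigr => b _.
    rewrite !mulr_sumr; apply: eq_bigr => c _.
    by rewrite -!mulrA (mulrCA (u a) (b ++ c == d)%:R) [LHS]mulrCA.
  rewrite exchange_big /=; apply: eq_bigr => b _.
  rewrite exchange_big /=; apply: eq_bigr => c _.
  rewrite sum_pick ?words_lt_uniq // mem_words_lt; case: ifP => // /negbT bc.
  case: eqP => [h|]; last by rewrite mul0r.
  by rewrite (nil0 0%N (b ++ c) a) // in bc; right.
rewrite (Tmul_wide _ _ wn).
transitivity (\sum_(d <- words_lt n) \sum_(c <- words_lt n) \sum_(a <- words_lt n)
   \sum_(b <- words_lt n) (a ++ b == d)%:R * ((d ++ c == w)%:R * (u a * v b * t c))).
  rewrite /X; under [RHS]eq_bigr => d _ do rewrite exchange_big /=.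
  rewrite [RHS]exchange_big /=; apply: eq_bigr => a _.
  under [RHS]eq_bigr => d _ do rewrite exchange_big /=.
  rewrite [RHS]exchange_big /=; apply: eq_bigr => b _.
  rewrite [RHS]exchange_big /=; apply: eq_bigr => c _.
  rewrite sum_pick ?words_lt_uniq // mem_words_lt catA; case: ifP => // /negbT ab.
  case: eqP => [h|]; last by rewrite mul0r.
  by rewrite (nil0 0%N (a ++ b) c) // in ab; left.
rewrite big_seq [RHS]big_seq; apply: eq_bigr => d; rewrite mem_words_lt => dn.
apply: eq_bigr => c _; rewrite (Tmul_wide _ _ dn) mulr_suml mulr_sumr.
apply: eq_bigr => a _; rewrite mulr_suml mulr_sumr; apply: eq_bigr => b _.
by rewrite -!mulrA mulrCA.
Qed.

Definition Tone : TT := Tword K [::].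

Lemma Tmul_word a b : Tmul (Tword K a) (Tword K b) = Tword K (a ++ b).
Proof.
apply/funext => w; rewrite /Tmul /Tword; case: eqP => [->|ne].
  have h : (size a < (size (a ++ b)).+1)%N by rewrite ltnS size_cat leq_addr.
  rewrite (bigD1 (Ordinal h)) //= take_size_cat // drop_size_cat // !eqxx mulr1.
  rewrite big1 ?addr0 // => i; rewrite -val_eqE /= => ia.
  case: eqP => [ta|]; last by rewrite mul0r.
  have := congr1 size ta; rewrite size_takel -1?ltnS // => e.
  by rewrite e eqxx in ia.
rewrite big1 // => i _; case: eqP => [ta|]; last by rewrite mul0r.
case: eqP => [db|]; last by rewrite mulr0.
by case: ne; rewrite -ta -db cat_take_drop.
Qed.

Lemma Tmul1l u : Tmul Tone u = u.
Proof.
apply/funext => w; rewrite /Tmul big_ord_recl /= take0 drop0 /Tone /Tword eqxx mul1r.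
rewrite big1 ?addr0 // => i _; rewrite /bump /= add1n.
by case: w i => [[]|T w i] //=; rewrite mul0r.
Qed.
Lemma Tmul1r u : Tmul u Tone = u.
Proof.
apply/funext => w; rewrite /Tmul big_ord_recr /= take_size drop_size /Tone /Tword eqxx mulr1.
rewrite big1 ?add0r // => i _; case: eqP => [e|]; last by rewrite mulr0.
have := ltn_ord i; rewrite -subn_gt0 -size_drop.
by rewrite e.
Qed.

Lemma lie_ideal_wordr u a : lie_ideal u -> lie_ideal (Tmul u (Tword K a)).
Proof.
elim=> [b T T' c||v t _ IHv _ IHt|c v _ IH].
- by rewrite /lie_gen -!TmulA Tmul_word; exact: lie_ideal_gen.
- by rewrite Tmul0l; exact: lie_ideal0.
- by rewrite TmulDl; exact: lie_idealD.
- by rewrite TmulZl; exact: lie_idealZ.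
Qed.
Lemma lie_ideal_wordl u a : lie_ideal u -> lie_ideal (Tmul (Tword K a) u).
Proof.
elim=> [b T T' c||v t _ IHv _ IHt|c v _ IH].
- by rewrite /lie_gen TmulA Tmul_word; exact: lie_ideal_gen.
- by rewrite Tmul0r; exact: lie_ideal0.
- by rewrite TmulDr; exact: lie_idealD.
- by rewrite TmulZr; exact: lie_idealZ.
Qed.

Lemma lie_ideal_sum (I : Type) (r : seq I) (F : I -> TT) :
  (forall i, lie_ideal (F i)) -> lie_ideal (\sum_(i <- r) F i).
Proof.
by move=> h; elim/big_ind: _ => //; [exact: lie_ideal0 | exact: lie_idealD].
Qed.

Lemma Tcomp_words n u :
  Tcomp n u = \sum_(a <- words_lt n.+1) (Tcomp n u a \*o Tword K a).
Proof.
apply/funext => w; rewrite fct_sumE /= /Tword.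
under eq_bigr => a _ do rewrite mulrC.
rewrite (sum_pick w (fun a => Tcomp n u a)) ?words_lt_uniq // mem_words_lt ltnS.
by case: leqP => // nw; rewrite /Tcomp gtn_eqF // mul0r.
Qed.

Lemma lie_ideal_compr n u v : lie_ideal u -> lie_ideal (Tmul u (Tcomp n v)).
Proof.
move=> h; rewrite Tcomp_words.
elim/big_rec: _ => [|a t _ IH]; first by rewrite Tmul0r; exact: lie_ideal0.
rewrite TmulDr TmulZr; apply: lie_idealD => //; apply: lie_idealZ.
exact: lie_ideal_wordr.
Qed.
Lemma lie_ideal_compl n u v : lie_ideal u -> lie_ideal (Tmul (Tcomp n v) u).
Proof.
move=> h; rewrite Tcomp_words.
elim/big_rec: _ => [|a t _ IH]; first by rewrite Tmul0l; exact: lie_ideal0.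
rewrite TmulDl TmulZl; apply: lie_idealD => //; apply: lie_idealZ.
exact: lie_ideal_wordl.
Qed.

Lemma Tcomp_mul n u v :
  Tcomp n (Tmul u v) = \sum_(i < n.+1) Tmul (Tcomp i u) (Tcomp (n - i)%N v).
Proof.
apply/funext => w; rewrite fct_sumE /Tcomp /Tmul exchange_big /= mulr_sumr.
apply: eq_bigr => j _; set a := take j w; set b := drop j w.
have -> : wdeg w = (wdeg a + wdeg b)%N by rewrite -wdeg_cat cat_take_drop.
have [ab|ab] := eqVneq (wdeg a + wdeg b)%N n.
  have an : (wdeg a < n.+1)%N by rewrite ltnS -ab leq_addr.
  rewrite (bigD1 (Ordinal an)) //= -{1}ab addKn !eqxx !mul1r big1 ?addr0 // => i.
  by rewrite -val_eqE /= eq_sym => /negPf->; rewrite !mul0r.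
rewrite mul0r big1 // => i _.
case: eqP => [ai|]; last by rewrite !mul0r.
case: eqP => [bi|]; last by rewrite !mul0r mulr0.
by move: ab; rewrite ai bi subnKC ?eqxx // -ltnS.
Qed.

Lemma Uker_mulr u v : u \in Uker -> Tmul u v \in Uker.
Proof.
move=> /UkerP h; apply/UkerP => n; rewrite Tcomp_mul; apply: lie_ideal_sum => i.
exact: lie_ideal_compr.
Qed.
Lemma Uker_mull u v : u \in Uker -> Tmul v u \in Uker.
Proof.
move=> /UkerP h; apply/UkerP => n; rewrite Tcomp_mul; apply: lie_ideal_sum => i.
exact: lie_ideal_compl.
Qed.

Lemma tactDr x u v : tact x (u + v) = tact x u + tact x v.
Proof.
apply/funext => S; rewrite -[RHS]/(tact x u S + tact x v S) /tact -big_split.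
by apply: eq_bigr => w _; rewrite /= -mulrDl.
Qed.
Lemma tactZr x c u : tact x (c \*o u) = c \*o tact x u.
Proof.
apply/funext => S; rewrite /= /tact mulr_sumr.
by apply: eq_bigr => w _; rewrite /= mulrA.
Qed.
Lemma tact0r x : tact x 0 = 0.
Proof. by apply/funext => S; rewrite /tact big1 // => w _; rewrite mul0r. Qed.
Lemma tactNr x u : tact x (- u) = - tact x u.
Proof. by apply/eqP; rewrite -addr_eq0 -tactDr addNr tact0r. Qed.
Lemma actw_0 w : actw (0 : PL) w = 0.
Proof. by elim: w => //= T w; rewrite prelie0l. Qed.
Lemma tact0l u : tact 0 u = 0.
Proof. by apply/funext => S; rewrite /tact big1 // => w _; rewrite actw_0 mulr0. Qed.

Lemma tact_in x y : tact x (Tin y) = prelie x y.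
Proof.
apply/funext => S; have Sn := leqnn (nvert S); set n := {2}(nvert S) in Sn.
rewrite (tactE _ _ Sn) (prelieE _ _ Sn).
transitivity (\sum_(w <- words_lt n) \sum_(T <- trees_lt n)
    ([:: T] == w)%:R * (y T * actw x w S)).
  rewrite big_seq [RHS]big_seq; apply: eq_bigr => -[|T [|T' w]] wn.
  - by rewrite mul0r big1 // => T _; rewrite mul0r.
  - rewrite /=; under eq_bigr => T0 _ do rewrite eqseq_cons andbT eq_sym.
    rewrite (sum_pick T (fun T0 => y T0 * prelie x (basis K T) S)) ?trees_lt_uniq //.
    by move: wn; rewrite mem_words_lt mem_trees_lt /wdeg /= addn0 => ->.
  - by rewrite mul0r big1 // => T0 _; rewrite eqseq_cons andbF mul0r.
rewrite exchange_big [RHS]exchange_big /=.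
rewrite big_seq [RHS]big_seq; apply: eq_bigr => T; rewrite mem_trees_lt => Tn.
rewrite (sum_pick [:: T] (fun w => y T * actw x w S)) ?words_lt_uniq //.
rewrite mem_words_lt /wdeg /= addn0 Tn (prelieE _ _ Sn) mulr_sumr.
apply: eq_bigr => A _.
under eq_bigr => B _ do rewrite /basis eq_sym -mulrA mulrCA.
rewrite (sum_pick T (fun B => x A * (gcount A B S)%:R)) ?trees_lt_uniq //.
by rewrite mem_trees_lt Tn mulrCA mulrA.
Qed.

Lemma tact_gen x a T T' b : tact x (lie_gen a T T' b) = 0.
Proof.
rewrite /lie_gen !tact_mul; set y := tact x _.
rewrite !(tactDr, tactNr) !tact_mul !tact_in.
set e := basis K T; set e' := basis K T'.
rewrite /bracket prelieBr (_ : _ - _ = 0) ?tact0l //.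
have := prelie_pre_lie y e e'.
move/eqP; rewrite -subr_eq0 => /eqP h; rewrite -[RHS]h.
by rewrite !opprB (AC (2*2) ((1*4)*(3*2))).
Qed.

Lemma tact_ideal x u : lie_ideal u -> tact x u = 0.
Proof.
elim=> [a T T' b||v t _ IHv _ IHt|c v _ IH].
- exact: tact_gen.
- exact: tact0r.
- by rewrite tactDr IHv IHt addr0.
- by rewrite tactZr IH; apply/funext => S; rewrite /= mulr0.
Qed.

Lemma tact_ker x u : u \in Uker -> tact x u = 0.
Proof.
move=> /UkerP h; apply/funext => S; rewrite /tact.
transitivity (\sum_(m < nvert S) tact x (Tcomp m u) S); last first.
  by rewrite big1 // => m _; rewrite tact_ideal.
rewrite /tact exchange_big /= big_seq [RHS]big_seq; apply: eq_bigr => w.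
rewrite mem_words_lt => wn; rewrite (bigD1 (Ordinal wn)) //= /Tcomp eqxx mul1r.
rewrite big1 ?addr0 // => i; rewrite -val_eqE /= eq_sym => /negPf->.
by rewrite !mul0r.
Qed.

Local Open Scope quotient_scope.
Definition Uhat := Quotient.quot Uker.
HB.instance Definition _ := GRing.Zmodule.on Uhat.
HB.instance Definition _ := Quotient.on Uhat.

Lemma eq_piU u v : reflect (\pi_Uhat u = \pi_Uhat v) (u - v \in Uker).
Proof. rewrite (Quotient.idealrBE Uker u v); exact: eqP. Qed.

Lemma repr_piU u : repr (\pi_Uhat u) - u \in Uker.
Proof. by apply/eq_piU; rewrite reprK. Qed.

Definition Umul (f g : Uhat) : Uhat := \pi_Uhat (Tmul (repr f) (repr g)).

Lemma pi_Umul u v : \pi_Uhat (Tmul u v) = Umul (\pi u) (\pi v).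
Proof.
apply/esym/eq_piU; set U := repr _; set V := repr _.
have -> : Tmul U V - Tmul u v = Tmul U (V - v) + Tmul (U - u) v.
  by rewrite TmulBl TmulBr addrA subrK.
by apply: rpredD; [apply: Uker_mull | apply: Uker_mulr]; exact: repr_piU.
Qed.

Lemma UmulA : associative Umul.
Proof.
elim/quotW=> u; elim/quotW=> v; elim/quotW=> t.
by rewrite -(pi_Umul v t) -(pi_Umul u v) -(pi_Umul u) -(pi_Umul _ t) TmulA.
Qed.
Lemma Umul1l : left_id (\pi_Uhat Tone) Umul.
Proof. by elim/quotW=> u; rewrite -(pi_Umul Tone u) Tmul1l. Qed.
Lemma Umul1r : right_id (\pi_Uhat Tone) Umul.
Proof. by elim/quotW=> u; rewrite -(pi_Umul u Tone) Tmul1r. Qed.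
Lemma piD u v : \pi_Uhat (u + v) = \pi_Uhat u + \pi_Uhat v.
Proof. exact: (Quotient.pi_add Uker u v). Qed.
Lemma piB u v : \pi_Uhat (u - v) = \pi_Uhat u - \pi_Uhat v.
Proof. by rewrite piD; congr (_ + _); exact: (Quotient.pi_opp Uker v). Qed.
Lemma UmulDl : left_distributive Umul +%R.
Proof.
elim/quotW=> u; elim/quotW=> v; elim/quotW=> t.
by rewrite -(pi_Umul u t) -(pi_Umul v t) -!piD -(pi_Umul (u + v)) TmulDl.
Qed.
Lemma UmulDr : right_distributive Umul +%R.
Proof.
elim/quotW=> u; elim/quotW=> v; elim/quotW=> t.
by rewrite -(pi_Umul u v) -(pi_Umul u t) -!piD -(pi_Umul u) TmulDr.
Qed.
HB.instance Definition _ :=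
  GRing.Zmodule_isPzRing.Build Uhat UmulA Umul1l Umul1r UmulDl UmulDr.

Definition Uin x : Uhat := \pi_Uhat (Tin x).

(* By Uact_pi this does not depend on the representative, and Uact_in and
   Uact_mul say that it is the action of Uhat extending prelie. *)
Definition Uact x (f : Uhat) : PL := tact x (repr f).

Lemma Uact_pi x u : Uact x (\pi_Uhat u) = tact x u.
Proof.
by apply/eqP; rewrite -subr_eq0 -tactNr -tactDr tact_ker // repr_piU.
Qed.

Lemma Uact_in x y : Uact x (Uin y) = prelie x y.
Proof. by rewrite Uact_pi tact_in. Qed.

Lemma Uact_mul x (f g : Uhat) : Uact x (f * g) = Uact (Uact x f) g.
Proof.
elim/quotW: f => u; elim/quotW: g => v.
by rewrite -[_ * _]pi_Umul !Uact_pi tact_mul.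
Qed.

Definition Tpow u n := iter n (Tmul u) Tone.

Lemma pi_Tpow u n : \pi_Uhat (Tpow u n) = \pi_Uhat u ^+ n.
Proof. by elim: n => // n IH; rewrite exprS -IH -[_ * _]pi_Umul. Qed.

(* The power series \sum_n a_n X^n evaluated at an element x of PL^; the sum is
   finite on each word as x^n is supported on words of length n (Tpow_size).
   See Useries_partial for the convergence of the partial sums in Uhat. *)
Definition Tseries (a : nat -> K) x : TT :=
  fun w => \sum_(n < (size w).+1) a n * Tpow (Tin x) n w.
Definition Useries a x : Uhat := \pi_Uhat (Tseries a x).

Lemma Tpow_size x n w : size w != n -> Tpow (Tin x) n w = 0.
Proof.
elim: n w => [|n IH] w sw; first by rewrite /= /Tone /Tword; case: w sw.
rewrite /= /Tmul big1 // => i _.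
have [s1|s1] := eqVneq (size (take i w)) 1%N; last first.
  by rewrite /Tin; case: (take i w) s1 => [|T [|? ?]] //; rewrite mul0r.
rewrite [Tpow _ _ _]IH ?mulr0 //; apply: contraNneq sw => s2.
by rewrite -(cat_take_drop i w) size_cat s1 s2.
Qed.

Lemma tact1 x : tact x Tone = x.
Proof.
apply/funext => S; rewrite /tact /Tone /Tword.
under eq_bigr => w _ do rewrite eq_sym.
rewrite (sum_pick [::] (fun w => actw x w S)) ?words_lt_uniq // mem_words_lt.
by rewrite nvert_gt0.
Qed.

Lemma tact_Tpow x y n : tact x (Tpow (Tin y) n) = iter n (prelie^~ y) x.
Proof.
elim: n x => [|n IH] x; first exact: tact1.
by rewrite iterSr -IH /= tact_mul tact_in.
Qed.

Lemma Uact_series x a y S : Uact x (Useries a y) S =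
  \sum_(n < nvert S) a n * iter n (prelie^~ y) x S.
Proof.
rewrite Uact_pi; under [RHS]eq_bigr => n _ do rewrite -tact_Tpow /tact mulr_sumr.
rewrite exchange_big /= /tact big_seq [RHS]big_seq; apply: eq_bigr => w.
rewrite mem_words_lt => wn; have sw := leq_ltn_trans (size_wdeg w) wn.
rewrite (bigD1 (Ordinal sw)) //= [X in _ + X]big1 ?addr0; last first.
  by move=> i; rewrite -val_eqE /= eq_sym => wi; rewrite Tpow_size // mul0r mulr0.
rewrite /Tseries (bigD1 ord_max) //= big1 ?addr0 ?mulrA // => i.
by rewrite -val_eqE /= eq_sym => wi; rewrite Tpow_size // mulr0.
Qed.

Lemma Useries_partial a x N : exists2 r : TT,
  (forall w, (wdeg w < N)%N -> r w = 0) &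
  Useries a x = \sum_(n < N) \pi_Uhat (a n \*o Tpow (Tin x) n) + \pi_Uhat r.
Proof.
exists (fun w => (N <= size w)%N%:R * Tseries a x w).
  move=> w wN; rewrite leqNgt (leq_ltn_trans (size_wdeg w) wN) mul0r //.
rewrite -raddf_sum -raddfD; congr (\pi _); apply/funext => w.
rewrite -[RHS]/((\sum_(n < N) _) w + _) fct_sumE /= /Tseries.
rewrite (bigD1 (ord_max : 'I_(size w).+1)) //= big1 ?addr0; last first.
  by move=> i; rewrite -val_eqE /= eq_sym => wi; rewrite Tpow_size // mulr0.
case: leqP => h; rewrite ?mul1r ?mul0r.
  by rewrite big1 ?add0r // => i _; rewrite Tpow_size ?mulr0 // gtn_eqF // (leq_trans _ h).
rewrite addr0 (bigD1 (Ordinal h)) //= big1 ?addr0 // => i.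
by rewrite -val_eqE /= eq_sym => wi; rewrite Tpow_size // mulr0.
Qed.
End Algebra2.

Section Series.
Variable K : fieldType.

Definition exp_coef (n : nat) : K := n`!%:R^-1.

(* The coefficients of x / (e^x - 1), by inversion of the power series
   (e^x - 1) / x (todd_coefP). *)
Fixpoint todd_seq (n : nat) : seq K :=
  if n is m.+1 then
    rcons (todd_seq m) (- \sum_(k < m.+1) (todd_seq m)`_k * exp_coef (n - k).+1)
  else [:: 1].
Definition todd_coef (n : nat) : K := (todd_seq n)`_n.

Lemma size_todd_seq n : size (todd_seq n) = n.+1.
Proof. by elim: n => //= n IH; rewrite size_rcons IH. Qed.

Lemma nth_todd_seq n k : (k <= n)%N -> (todd_seq n)`_k = todd_coef k.
Proof.
elim: n => [|n IH] kn; first by case: k kn.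
move: kn; rewrite leq_eqVlt => /orP[/eqP->//|kn].
by rewrite /= nth_rcons size_todd_seq kn IH.
Qed.

Lemma exp_coef0 : exp_coef 0 = 1.
Proof. by rewrite /exp_coef fact0 invr1. Qed.
Lemma exp_coef1 : exp_coef 1 = 1.
Proof. by rewrite /exp_coef factS fact0 invr1. Qed.

Lemma todd_coefP n :
  \sum_(k < n.+1) todd_coef k * exp_coef (n - k).+1 = (n == 0%N)%:R.
Proof.
case: n => [|n]; first by rewrite big_ord_recl big_ord0 /todd_coef /exp_coef /= invr1 mulr1 addr0.
rewrite big_ord_recr /= subnn {2}/todd_coef /= nth_rcons size_todd_seq ltnn eqxx.
rewrite exp_coef1 mulr1.
apply/eqP; rewrite subr_eq0; apply/eqP; apply: eq_bigr => k _.
by rewrite nth_todd_seq // -ltnS.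
Qed.

Definition Uexp (x : PLhat K) : Uhat K := Useries exp_coef x.
Definition Utodd (x : PLhat K) : Uhat K := Useries todd_coef x.

(* A[c] = \sum_n c^n A_n, where A_n is the component of degree n of A. *)
Definition dil (c : K) (x : PLhat K) : PLhat K := fun T => c ^+ nvert T * x T.

Lemma UactBr (x : PLhat K) (f g : Uhat K) : Uact x (f - g) = Uact x f - Uact x g.
Proof.
elim/quotW: f => u; elim/quotW: g => v.
by rewrite -piB !Uact_pi tactDr tactNr.
Qed.
Lemma Uact1 (x : PLhat K) : Uact x 1 = x.
Proof. by rewrite -[1]/(\pi_(Uhat K)%qT (Tone K)) Uact_pi tact1. Qed.

Lemma iter_local n k (x x' y y' : PLhat K) S : (nvert S <= n)%N ->
  (forall T, (nvert T < n)%N -> x T = x' T) ->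
  (forall T, (nvert T < n)%N -> y T = y' T) ->
  iter k.+1 (fun z => prelie z y) x S = iter k.+1 (fun z => prelie z y') x' S.
Proof.
elim: k S => [|k IH] S Sn xx' yy'; first exact: (prelie_local Sn).
rewrite -[LHS]/(prelie (iter k.+1 (prelie^~ y) x) y S).
rewrite -[RHS]/(prelie (iter k.+1 (prelie^~ y') x') y' S).
by apply: (prelie_local Sn) => // T /ltnW Tn; exact: IH.
Qed.

Lemma fixpoint_ex (F : PLhat K -> PLhat K) :
  (forall n x y, (forall T, (nvert T < n)%N -> x T = y T) ->
     forall T, (nvert T <= n)%N -> F x T = F y T) -> exists! x, F x = x.
Proof.
move=> H; pose s n := iter n F 0.
have st n m T : (nvert T <= n)%N -> (n <= m)%N -> s m T = s n T.
  elim: n m T => [|n IH] m T Tn; first by have := nvert_gt0 T; rewrite ltnNge Tn.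
  case: m => // m nm; apply: (H n.+1) => // T' T'n.
  exact: IH.
exists (fun T => s (nvert T) T); split=> [|y Fy]; apply/funext => T.
  have := st (nvert T) (nvert T).+1 T (leqnn _) (leqnSn _); move=> <-.
  apply: (H (nvert T)) => // T' T'n.
  by symmetry; apply: st => //; exact: ltnW.
suff : forall n T, (nvert T <= n)%N -> s n T = y T by apply.
elim=> [|n IH] T' T'n; first by have := nvert_gt0 T'; rewrite ltnNge T'n.
by rewrite -Fy; apply: (H n.+1) => // T''; exact: IH.
Qed.
End Series.

Definition Qq : fieldType := {fraction {poly rat}}.
Definition toQq : {poly rat} -> Qq := @FracField.tofrac {poly rat}.
Definition qvar : Qq := toQq 'X.

Definition ext_q (x : PLhat rat) : PLhat Qq := fun T => toQq (x T)%:P.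

Definition is_Omega (Om : PLhat rat) : Prop :=
  Uact (basis rat bullet) (Utodd Om) = Om.

Definition is_Omega_q (Om : PLhat rat) (Oq : PLhat Qq) : Prop :=
  Uact (dil qvar Oq) (Uexp (ext_q Om) - 1) + dil qvar Oq - Oq =
  prelie (basis Qq bullet) Oq + (qvar - 1) \*o basis Qq bullet.

(* is_Omega and is_Omega_q each determine exactly one series
   (Omega_exists_unique, Omega_q_exists_unique). *)
Lemma Omega_exists_unique : exists! Om, is_Omega Om.
Proof.
apply: (@fixpoint_ex rat (fun Om => Uact (basis rat bullet) (Utodd Om))).
move=> n x y xy S Sn; rewrite !Uact_series; apply: eq_bigr => -[[|k] kS] _ //=.
by congr (_ * _); apply: (@iter_local _ n k).
Qed.

Lemma qvar_neq1 n : (0 < n)%N -> qvar ^+ n - 1 != 0.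
Proof.
move=> n0; rewrite /qvar /toQq -tofracXn -tofrac1 -tofracB tofrac_eq0.
by rewrite -size_poly_eq0 size_XnsubC.
Qed.

Lemma Omega_q_exists_unique Om : exists! Oq, is_Omega_q Om Oq.
Proof.
pose y := ext_q Om.
pose G (Oq : PLhat Qq) : PLhat Qq := fun S => (qvar ^+ nvert S - 1)^-1 *
  ((prelie (basis Qq bullet) Oq + (qvar - 1) \*o basis Qq bullet
   - (Uact (dil qvar Oq) (Uexp y) - dil qvar Oq)) S).
have [|O [GO uO]] := @fixpoint_ex Qq G.
  move=> n x x' xx' S Sn; rewrite /G; congr (_ * _).
  rewrite -[LHS]/(_ + _ - (_ - _)) -[RHS]/(_ + _ - (_ - _)) /=.
  congr (_ + _ - _); first exact: (prelie_local Sn).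
  rewrite !Uact_series; case: (nvert S) (nvert_gt0 S) => // m _.
  rewrite !big_ord_recl exp_coef0 !mul1r /= ![dil _ _ S + _]addrC !addrK.
  apply: eq_bigr => k _; congr (_ * _); apply: (@iter_local _ n k) => // T Tn.
  by rewrite /dil xx'.
have GE X : is_Omega_q Om X <-> G X = X.
  rewrite /is_Omega_q UactBr Uact1 -/y subrK.
  split=> [e|e]; apply/funext => S.
    rewrite /G -e; apply: (canLR (mulKf (qvar_neq1 (nvert_gt0 S)))).
    rewrite -[LHS]/(Uact (dil qvar X) (Uexp y) S - X S
      - (Uact (dil qvar X) (Uexp y) S - qvar ^+ nvert S * X S)).
    by rewrite opprB addrC addrA subrK mulrBl mul1r.
  have := congr1 (fun Y : PLhat Qq => Y S) e; rewrite /= /G.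
  move/(canRL (mulVKf (qvar_neq1 (nvert_gt0 S)))).
  set r := prelie _ _ + _; rewrite -[_ S]/(r S - (Uact (dil qvar X) (Uexp y) S
       - qvar ^+ nvert S * X S)) => h.
  rewrite -[LHS]/(Uact (dil qvar X) (Uexp y) S - X S).
  move/eqP: h; rewrite subr_eq => /eqP->; rewrite mulrBl mul1r.
  by rewrite [RHS]addrC addrA subrK.
exists O; split; first exact/GE.
by move=> X /GE; exact: uO.
Qed.

(* f has no pole at a; a fraction n / d need not be reduced. *)
Definition regular_at (a : rat) (f : Qq) : Prop :=
  exists n d : {poly rat}, d.[a] != 0 /\ f = toQq n / toQq d.

Definition has_value_at (a : rat) (f : Qq) (v : rat) : Prop :=
  exists n d : {poly rat}, [/\ d.[a] != 0, f = toQq n / toQq d & v = n.[a] / d.[a]].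

Lemma has_value_at_fun a f v v' : has_value_at a f v -> has_value_at a f v' -> v = v'.
Proof.
move=> [n [d [da -> ->]]] [n' [d' [da' /eqP e ->]]].
have d0 : toQq d != 0 by rewrite tofrac_eq0; apply: contraNneq da => ->; rewrite horner0.
have d0' : toQq d' != 0 by rewrite tofrac_eq0; apply: contraNneq da' => ->; rewrite horner0.
move: e; rewrite eqr_div // -!tofracM tofrac_eq => /eqP e.
by apply/eqP; rewrite eqr_div // -!hornerM e.
Qed.

(* Main.v *)
(* In the free pre-Lie algebra with an element id adjoined (id <| y = y), let
   R_y be the action of y, N the degree operator and E = exp(R_Omega).  The
   equation of Omega says that E id = id + bullet, and that of X = Omega_q then
   gives, with e = 1 - q and X[q] the rescaled series,
     E (R_{X[q]} - e N) = (R_X - e N) E.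
   Hence L = R_X - e N commutes with S = E q^N; as the eigenvalue of L in degree
   n is - e n and that of S is q^n = (1 - e)^n, S = sum_k (1/k!) prod_{i<k} (L + e i)
   by the binomial formula.  Applying this to id yields the identity
     id + bullet = sum_k (1/k!) prod_{i<k} (R_X - e (N - i)) id,
   whose component of degree n involves X_n with a coefficient of value 1 at
   q = 1, and otherwise only components of X of lower degree.  So X is regular by
   induction, and at q = 1 the identity becomes id + bullet = exp(R_X) id, which
   determines Omega. *)
Require Import Defs.
From HB Require Import structures.
From mathcomp Require Import all_boot all_order all_algebra.
From mathcomp Require Import fraction boolp functions.
From mathcomp Require Import ring.

Set Implicit Arguments.
Unset Strict Implicit.
Unset Printing Implicit Defensive.

Import GRing.Theory.
Local Open Scope ring_scope.

(** * Rearranging sums, and iterated commutators *)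

Lemma sum_triangle (V : nmodType) n (F : nat -> nat -> V) :
  (forall j l, (n < j + l)%N -> F j l = 0) ->
  \sum_(k < n.+1) \sum_(j < k.+1) F j (k - j)%N =
  \sum_(j < n.+1) \sum_(l < n.+1) F j l.
Proof.
move=> F0.
transitivity (\sum_(k < n.+1) \sum_(j < n.+1 | (j <= k)%N) F j (k - j)%N).
  apply: eq_bigr => k _; rewrite (big_ord_widen n.+1 (fun j => F j (k - j)%N)) //.
rewrite (exchange_big_dep xpredT) //=; apply: eq_bigr => j _.
rewrite -(big_mkord (fun k => (j <= k)%N) (fun k => F j (k - j)%N)).
rewrite (big_cat_nat _ (n := j)) ?leq0n //=; last exact: ltnW.
rewrite big_nat_cond big1 ?add0r; last first.
  by move=> i /andP[/andP[_ ij]]; rewrite leqNgt ij.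
rewrite -{1}[nat_of_ord j]add0n big_addn.
under eq_bigl do rewrite leq_addl.
under eq_bigr do rewrite addnK.
rewrite -(big_mkord xpredT (fun l => F j l)).
rewrite [RHS](big_cat_nat _ (n := (n.+1 - j)%N)) ?leq0n ?leq_subr //=.
rewrite [X in _ = _ + X]big_nat_cond [X in _ = _ + X]big1 ?addr0 // => l.
by move=> /andP[/andP[jl _] _]; apply: F0; move: jl; rewrite leq_subLR.
Qed.

(** The hypothesis reads [R, Z_j] = Z_(j+1), so Z_j is ad_R^j(Z_0) and this is the Leibniz rule for
    R^k Z_0, by induction on k with Pascal's rule. *)
Lemma iter_commutator (V : zmodType) (R : {additive V -> V}) (Z : nat -> V -> V) :
  (forall j v, R (Z j v) = Z j (R v) + Z j.+1 v) ->
  forall k v, iter k R (Z 0 v) =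
    \sum_(j < k.+1) Z j (iter (k - j) R v) *+ 'C(k, j).
Proof.
move=> RZ; elim=> [|k IH] v; first by rewrite big_ord_recl big_ord0 addr0.
rewrite iterS IH raddf_sum.
under eq_bigr => j _ do rewrite raddfMn RZ mulrnDl -iterS -subSn ?leq_ord //.
rewrite big_split /= [RHS]big_ord_recl [X in X + _ = _]big_ord_recl /= !bin0 -addrA; congr (_ + _).
under [RHS]eq_bigr => j _ do rewrite /bump add1n binS mulrnDr.
rewrite big_split /= [X in _ = X + _]big_ord_recr /= bin_small // mulr0n addr0.
by under eq_bigr => j _ do rewrite /bump add1n subSS.
Qed.

(** * The right action of PL^ on itself with id adjoined *)

Section Action.
Variable K : fieldType.
Local Notation PL := (PLhat K).
(* The coefficient at None is that of the adjoined element. *)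
Local Notation V := (option rtree -> K).
Implicit Types (x y : PL) (u v : V) (o : option rtree).

Definition odeg o : nat := if o is Some T then nvert T else 0%N.

(** The summand [v None * y T] encodes id <| y = y. Nothing is sent to id, which has degree 0, so
    [act y] strictly raises the degree. *)
Definition act y v : V := fun o =>
  if o is Some T then v None * y T + prelie (v \o some) y T else 0.

Definition idv : V := fun o => (o == None)%:R.

Definition emb x : V := fun o => if o is Some T then x T else 0.

Lemma prelieZl c x y T : prelie (fun S => c * x S) y T = c * prelie x y T.
Proof.
rewrite /prelie mulr_sumr; apply: eq_bigr => A _; rewrite mulr_sumr.
by apply: eq_bigr => B _; rewrite !mulrA.
Qed.

Lemma prelieZr c x y T : prelie x (fun S => c * y S) T = c * prelie x y T.
Proof.
rewrite /prelie mulr_sumr; apply: eq_bigr => A _; rewrite mulr_sumr.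
by apply: eq_bigr => B _; rewrite !mulrA (mulrC c).
Qed.

Lemma act_is_additive y : zmod_morphism (act y).
Proof.
move=> u v; apply/funext => -[T|]; rewrite -[RHS]/(_ - _) /act; last by rewrite subrr.
by rewrite (prelieBl (u \o some) (v \o some)) -[(_ - _ : PL) T]/(_ - _)
  -[(u - v) None]/(_ - _); ring.
Qed.
HB.instance Definition _ y := GRing.isZmodMorphism.Build V V (act y) (act_is_additive y).

Lemma actDr y u v : act y (u + v) = act y u + act y v. Proof. exact: raddfD. Qed.
Lemma actBr y u v : act y (u - v) = act y u - act y v. Proof. exact: raddfB. Qed.

Lemma actZr c y v : act y (c \*o v) = c \*o act y v.
Proof.
apply/funext => -[T|] /=; rewrite ?mulr0 //.
by rewrite (prelieZl c (v \o some)); ring.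
Qed.

Lemma actZl c y v : act (c \*o y) v = c \*o act y v.
Proof.
by apply/funext => -[T|] /=; rewrite ?mulr0 // (prelieZr c _ y); ring.
Qed.

Lemma actDl x y v : act (x + y) v = act x v + act y v.
Proof.
apply/funext => -[T|]; rewrite -[RHS]/(_ + _) /= ?addr0 // prelieDr.
by rewrite -![(_ + _ : PL) T]/(_ + _); ring.
Qed.

Lemma act0l v : act 0 v = 0.
Proof.
by apply/eqP; rewrite -(inj_eq (addrI (act 0 v))) -actDl !addr0.
Qed.

Lemma actNl y v : act (- y) v = - act y v.
Proof. by apply/eqP; rewrite -addr_eq0 -actDl addNr act0l. Qed.

Lemma act_idv y : act y idv = emb y.
Proof.
apply/funext => -[T|] //=; rewrite mul1r (_ : _ \o _ = 0) ?prelie0l ?addr0 //.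
Qed.

Lemma act_emb y x : act y (emb x) = emb (prelie x y).
Proof. by apply/funext => -[T|] //=; rewrite mul0r add0r. Qed.

Lemma iter_act_emb k y x : iter k (act y) (emb x) = emb (iter k (prelie^~ y) x).
Proof. by elim: k => //= k ->; rewrite act_emb. Qed.

(** On the tree part this is the pre-Lie identity; on id it is the definition of the bracket. So
    commutators of operators R_x are again such operators. *)
Lemma act_lie x y v : act y (act x v) = act x (act y v) + act (bracket x y) v.
Proof.
apply/funext => -[T|]; rewrite -[RHS]/(_ + _) /= ?addr0 // !mul0r !add0r.
have eact z : act z v \o some = v None \*o z + prelie (v \o some) z by [].
rewrite !eact !prelieDl -![(_ + _ : PL) T]/(_ + _) !(prelieZl (v None)).
have := congr1 (fun f : PL => f T) (prelie_pre_lie (v \o some) x y).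
rewrite /bracket prelieBr -![(_ - _ : PL) T]/(_ - _) => h.
apply/eqP; rewrite -subr_eq0; apply/eqP; rewrite -[RHS](subrr
  (prelie (prelie (v \o some) x) y T - prelie (v \o some) (prelie x y) T)) {2}h.
by ring.
Qed.

(** The bound is strict for v because y has no part of degree 0, but not for y because id
    contributes [y T] itself. *)
Lemma act_local n y y' v v' o : (odeg o <= n)%N ->
  (forall T, (nvert T <= n)%N -> y T = y' T) ->
  (forall o', (odeg o' < n)%N -> v o' = v' o') -> act y v o = act y' v' o.
Proof.
case: o => [T|] //= Tn yy' vv'; rewrite yy' // vv' /=; last first.
  exact: leq_trans (nvert_gt0 T) Tn.
congr (_ + _); apply: (prelie_local Tn) => S Sn /=; first exact: vv'.
exact/yy'/ltnW.
Qed.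

Lemma act_low r m y v : (forall T, (nvert T < r)%N -> y T = 0) ->
  (forall o, (odeg o < m)%N -> v o = 0) ->
  forall o, (odeg o < m + r)%N -> act y v o = 0.
Proof.
move=> y0 v0 [T|] //= Tn; rewrite (prelie_low _ y0 Tn) => [|S Sm]; last exact: v0.
have [Tr|rT] := ltnP (nvert T) r; first by rewrite y0 // mulr0 addr0.
rewrite v0 ?mul0r ?addr0 //=; move: Tn; case: m {v0} => //.
by rewrite add0n ltnNge rT.
Qed.

Lemma low1 x T : (nvert T < 1)%N -> x T = 0.
Proof. by rewrite ltnS leqn0 => /eqP T0; have := nvert_gt0 T; rewrite T0. Qed.

Lemma act_low1 m y v : (forall o, (odeg o < m)%N -> v o = 0) ->
  forall o, (odeg o < m.+1)%N -> act y v o = 0.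
Proof. by move=> v0 o om; apply: (act_low (r := 1) _ v0); [exact: low1 | rewrite addn1]. Qed.

Lemma iter_act_low k m y v : (forall o, (odeg o < m)%N -> v o = 0) ->
  forall o, (odeg o < m + k)%N -> iter k (act y) v o = 0.
Proof.
move=> v0; elim: k => [|k IH] o; first by rewrite addn0; exact: v0.
by rewrite addnS /=; exact: act_low1.
Qed.

Lemma iter_act_local k n y v v' o : (odeg o <= n)%N ->
  (forall o', (odeg o' <= n)%N -> v o' = v' o') ->
  iter k (act y) v o = iter k (act y) v' o.
Proof.
move=> on vv'; elim: k o on => [|k IH] o on; first exact: vv'.
by rewrite /=; apply: (act_local on) => // o' /ltnW; exact: IH.
Qed.

Lemma act_sumr n y (c : nat -> K) (w : nat -> V) :
  act y (fun o => \sum_(i < n) c i * w i o) =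
  fun o => \sum_(i < n) c i * act y (w i) o.
Proof.
have fE (u : nat -> V) : (fun o => \sum_(i < n) c i * u i o) = \sum_(i < n) c i \*o u i.
  by apply/funext => o; rewrite fct_sumE.
by rewrite (fE w) (fE (fun i => act y (w i))) raddf_sum; apply: eq_bigr => i _; exact: actZr.
Qed.

Lemma iter_act_sum k n y (c : nat -> K) (w : nat -> V) :
  iter k (act y) (fun o => \sum_(i < n) c i * w i o) =
  fun o => \sum_(i < n) c i * iter k (act y) (w i) o.
Proof. by elim: k => //= k ->; rewrite (act_sumr _ _ c (fun i => iter k (act y) (w i))). Qed.

Lemma act_suml n v (c : nat -> K) (w : nat -> PL) :
  act (fun T => \sum_(i < n) c i * w i T) v =
  fun o => \sum_(i < n) c i * act (w i) v o.
Proof.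
have fE (U : Type) (u : nat -> U -> K) :
    (fun o : U => \sum_(i < n) c i * u i o) = \sum_(i < n) c i \*o u i.
  by apply/funext => o; rewrite fct_sumE.
rewrite (fE _ w) (fE _ (fun i => act (w i) v)) (big_morph (act^~ v) (fun x y => actDl x y v) (act0l v)).
by apply: eq_bigr => i _; exact: actZl.
Qed.

(** * The degree operator N ([eul], [euv]) and the rescaling c^N ([dil], [dilv]) *)

Lemma prelie_deg (c : K) (f : nat -> nat -> K) x y T :
  (forall A B, nvert T = (nvert A + nvert B)%N -> f (nvert A) (nvert B) = c) ->
  c * prelie x y T =
  \sum_(A <- trees_lt (nvert T)) \sum_(B <- trees_lt (nvert T))
     f (nvert A) (nvert B) * (x A * y B * (gcount A B T)%:R).
Proof.
move=> fT; rewrite /prelie mulr_sumr; apply: eq_bigr => A _.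
rewrite mulr_sumr; apply: eq_bigr => B _.
have [/fT->//|d] := eqVneq (nvert T) (nvert A + nvert B)%N.
by rewrite (gcount_deg d) !mulr0.
Qed.

Definition eul x : PL := fun T => (nvert T)%:R * x T.
Definition euv v : V := fun o => (odeg o)%:R * v o.
Definition dilv (c : K) v : V := fun o => c ^+ odeg o * v o.

(** [N, R_y] = R_(N y), as degrees add under grafting. *)
Lemma euv_act y v : euv (act y v) = act (eul y) v + act y (euv v).
Proof.
apply/funext => -[T|]; rewrite /euv -[RHS]/(_ + _) /= ?mul0r ?add0r // /euv /eul /=.
rewrite mulrDr (@prelie_deg _ (fun a b => (a + b)%:R)); last by move=> A B ->.
rewrite (_ : \sum_(A <- _) _ = prelie (euv v \o some) y T + prelie (v \o some) (eul y) T).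
  by rewrite /euv /eul /=; ring.
rewrite /prelie -big_split; apply: eq_bigr => A _; rewrite -big_split.
by apply: eq_bigr => B _; rewrite /euv /eul /= natrD; ring.
Qed.

Lemma dilv_act c y v : dilv c (act y v) = act (dil c y) (dilv c v).
Proof.
apply/funext => -[T|]; rewrite /dilv /= ?mulr0 // /dil expr0 mul1r.
rewrite mulrDr (@prelie_deg _ (fun a b => c ^+ (a + b))); last by move=> A B ->.
rewrite (_ : \sum_(A <- _) _ = prelie (dilv c v \o some) (dil c y) T) ?/dilv /=; first by ring.
rewrite /prelie; apply: eq_bigr => A _.
by apply: eq_bigr => B _; rewrite /dilv /dil /= exprD; ring.
Qed.

(** * Power series in R_y, and the operators R_y - e N + c *)

Definition ser (a : nat -> K) y v : V := fun o =>
  \sum_(k < (odeg o).+1) a k * iter k (act y) v o.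

Lemma serE n a y v o : (odeg o <= n)%N ->
  ser a y v o = \sum_(k < n.+1) a k * iter k (act y) v o.
Proof.
rewrite -ltnS => on; rewrite /ser (big_ord_widen n.+1 (fun k => a k * iter k (act y) v o)) //.
rewrite big_mkcond; apply: eq_bigr => k _ /=; case: ltnP => // ok.
by rewrite (@iter_act_low k 0) ?mulr0.
Qed.

Lemma Uact_ser x a y T : Uact x (Useries a y) T = ser a y (emb x) (Some T).
Proof.
(* [ser] has one more term than [Uact_series], of index [nvert T]; it vanishes as [emb x] starts in
   degree 1. *)
rewrite Uact_series /ser big_ord_recr /= (@iter_act_low _ 1) //; last first.
  by move=> [S|] //; exact: low1.
by rewrite mulr0 addr0; apply: eq_bigr => k _; rewrite iter_act_emb.
Qed.

Lemma ser_ser a b y v o : ser a y (ser b y v) o =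
  \sum_(k < (odeg o).+1) (\sum_(j < k.+1) a j * b (k - j)%N) * iter k (act y) v o.
Proof.
set n := odeg o; pose F j l := a j * (b l * iter (j + l) (act y) v o).
transitivity (\sum_(j < n.+1) \sum_(l < n.+1) F j l).
  apply: eq_bigr => j _; rewrite -mulr_sumr; congr (_ * _).
  transitivity (iter j (act y) (fun o => \sum_(l < n.+1) b l * iter l (act y) v o) o).
    by apply: (@iter_act_local j n) => // o' o'n; exact: serE.
  rewrite (iter_act_sum _ _ y b (fun l => iter l (act y) v)).
  by apply: eq_bigr => l _; rewrite iterD.
rewrite -sum_triangle => [|j l jl]; last first.
  by rewrite /F (@iter_act_low _ 0) ?mulr0.
apply: eq_bigr => k _; rewrite mulr_suml; apply: eq_bigr => j _.
by rewrite /F subnKC ?mulrA // -ltnS.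
Qed.

Lemma ser0 a y v : ser a y v None = a 0%N * v None.
Proof. by rewrite /ser big_ord_recl big_ord0 addr0. Qed.

Lemma ser_is_additive a y : zmod_morphism (ser a y).
Proof.
move=> u v; apply/funext => o; rewrite -[RHS]/(_ - _) -sumrB; apply: eq_bigr => k _.
suff -> : iter k (act y) (u - v) = iter k (act y) u - iter k (act y) v by rewrite -mulrBr.
by elim: (k : nat) => //= i ->; rewrite raddfB.
Qed.
HB.instance Definition _ a y := GRing.isZmodMorphism.Build V V (ser a y) (ser_is_additive a y).

Lemma serZ a y c v : ser a y (c \*o v) = c \*o ser a y v.
Proof.
apply/funext => o; rewrite /ser /= mulr_sumr; apply: eq_bigr => k _.
suff -> : iter k (act y) (c \*o v) = c \*o iter k (act y) v by rewrite /= mulrCA.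
by elim: (k : nat) => //= i ->; rewrite actZr.
Qed.

Lemma ser_lead a y m v o : (forall o, (odeg o < m)%N -> v o = 0) ->
  (odeg o <= m)%N -> ser a y v o = a 0%N * v o.
Proof.
move=> v0 om; rewrite /ser big_ord_recl big1 ?addr0 // => i _.
rewrite (@iter_act_low _ m) ?mulr0 // (leq_ltn_trans om) //.
by rewrite lift0 addnS ltnS leq_addr.
Qed.

(* With c := e * i this is e (i - N) for N := deg - e^-1 (act y). *)
Definition shift y (e c : K) v : V := fun o =>
  act y v o + (c - e * (odeg o)%:R) * v o.

Lemma shiftE y e c v : shift y e c v = act y v + (c \*o v - e \*o euv v).
Proof.
apply/funext => o; rewrite -[RHS]/(_ + (c * v o - e * (_ * v o))) /shift.
by congr (_ + _); ring.
Qed.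

Lemma shift_is_additive y e c : zmod_morphism (shift y e c).
Proof.
move=> u v; apply/funext => o; rewrite -[RHS]/(shift y e c u o - shift y e c v o) /shift.
rewrite raddfB -[(u - v) o]/(u o - v o) -[(_ - _ : V) o]/(act y u o - act y v o).
by ring.
Qed.
HB.instance Definition _ y e c :=
  GRing.isZmodMorphism.Build V V (shift y e c) (shift_is_additive y e c).

Lemma shiftZ y e c d v : shift y e c (d \*o v) = d \*o shift y e c v.
Proof. by apply/funext => o; rewrite /shift actZr /=; ring. Qed.

(** The two operators differ by a scalar. *)
Lemma shift_comm y e c d v : shift y e c (shift y e d v) = shift y e d (shift y e c v).
Proof.
have sE c' w : shift y e c' w = shift y e 0 w + c' \*o w.
  by apply/funext => o; rewrite -[RHS]/(_ + _) /shift /=; ring.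
have sD w : shift y e 0 (shift y e 0 v + w) = shift y e 0 (shift y e 0 v) + shift y e 0 w.
  exact: raddfD.
rewrite !(sE c) !(sE d) !sD !shiftZ; apply/funext => o.
by rewrite -[LHS]/(_ + _ + (c * (_ + _))) -[RHS]/(_ + _ + (d * (_ + _))) /=; ring.
Qed.

Lemma shift_local n y e c v v' o : (odeg o <= n)%N ->
  (forall o', (odeg o' <= n)%N -> v o' = v' o') -> shift y e c v o = shift y e c v' o.
Proof.
move=> on vv'; rewrite /shift vv' //; congr (_ + _).
by apply: (act_local on) => // o' /ltnW; exact: vv'.
Qed.

Lemma shift_low m y e c v : (forall o, (odeg o < m)%N -> v o = 0) ->
  forall o, (odeg o < m)%N -> shift y e c v o = 0.
Proof. by move=> v0 o om; rewrite /shift v0 // mulr0 (act_low1 _ v0) ?addr0 // ltnW. Qed.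

(** R_y raises the degree, so only the scalar part is seen in the lowest degree m: this gives the
    eigenvalues. *)
Lemma shift_lead m y e c v o : (forall o, (odeg o < m)%N -> v o = 0) ->
  (odeg o <= m)%N -> shift y e c v o = (c - e * m%:R) * v o.
Proof.
move=> v0 om; rewrite /shift (act_low1 _ v0) // add0r.
by move: om; rewrite leq_eqVlt => /orP[/eqP->//|om]; rewrite v0 // !mulr0.
Qed.

(** * Conjugation by the exponential of R_y *)

Lemma bracket_low m x y : (forall T, (nvert T < m)%N -> x T = 0) ->
  forall T, (nvert T < m.+1)%N -> bracket x y T = 0.
Proof.
move=> x0 T Tm; rewrite -[LHS]/(_ - _).
rewrite (@prelie_low _ m 1) ?(@prelie_low _ 1 m) ?subrr ?addn1 ?add1n //; exact: low1.
Qed.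

Lemma iter_bracket_low k x y T : (nvert T < k.+1)%N ->
  iter k (fun z => bracket z y) x T = 0.
Proof.
elim: k T => [|k IH] T; first exact: low1.
by rewrite /=; apply: bracket_low.
Qed.

Hypothesis K0 : forall n, n.+1%:R != 0 :> K.

Lemma fact_neq0 n : n`!%:R != 0 :> K.
Proof. by rewrite -(prednK (fact_gt0 n)). Qed.

Lemma exp_coef_bin j k : (j <= k)%N ->
  exp_coef K k * 'C(k, j)%:R = exp_coef K j * exp_coef K (k - j).
Proof.
move=> jk; rewrite /exp_coef -(bin_fact jk) !natrM.
have := fact_neq0 k; rewrite -(bin_fact jk) !natrM !mulf_eq0 !negb_or => /and3P[b0 f0 f1].
by field; rewrite b0 f0 f1.
Qed.

Local Notation Exp := (ser (exp_coef K)).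

(* For R = act y and Z = shift x e 0: e^R Z = (sum_j ad_R^j(Z) / j!) e^R, and
   ad_R^j(Z) is the action of an element of PL^ for j > 0. *)
Lemma exp_shift x y e : exists W, forall v,
  Exp y (shift x e 0 v) = shift x e 0 (Exp y v) + act W (Exp y v).
Proof.
(* With Z = R_x - e N: [R_y, R_x] is the action of [bracket x y] and [R_y, -e N] = e [N, R_y] that
   of e times [eul y], so [R_y, Z] is the action of U. As [R_y, R_z] is that of [bracket z y], [u i]
   gives the (i+1)-fold commutator. *)
pose U : PL := bracket x y + e \*o eul y.
pose u i := iter i (fun z => bracket z y) U.
(* [u j] starts in degree j + 1, so the other j do not contribute at T. *)
exists (fun T => \sum_(j < nvert T) exp_coef K j.+1 * u j T) => v.
pose Z j w := if j is i.+1 then act (u i) w else shift x e 0 w.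
have RZ j w : act y (Z j w) = Z j (act y w) + Z j.+1 w.
  case: j => [|j]; last exact: act_lie.
  rewrite -[Z 1%N w]/(act (bracket x y + e \*o eul y) w) /Z !shiftE actDr actBr !actZr euv_act act_lie.
  rewrite [act (_ + _) w]actDl actZl.
  apply/funext => o.
  rewrite -[LHS]/(_ + _ + (_ - _)) -[RHS]/(_ + (_ - (e * (_ + _))) + (_ + _)) /=.
  by ring.
have Zlow j l o : (odeg o < j + l)%N -> Z j (iter l (act y) v) o = 0.
  have il : forall o, (odeg o < l)%N -> iter l (act y) v o = 0.
    exact: (@iter_act_low _ 0).
  case: j => [|j] ol /=; first exact: shift_low ol.
  by apply: (act_low (@iter_bracket_low j U y) il); rewrite addnC.
(* [Z j] passes through the infinite sum [Exp], since its coefficient at o depends only on degrees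
   up to [odeg o]. *)
have Zlin j o : Z j (Exp y v) o = \sum_(l < (odeg o).+1) exp_coef K l * Z j (iter l (act y) v) o.
  set n := odeg o.
  pose w o := \sum_(l < n.+1) exp_coef K l * iter l (act y) v o.
  transitivity (Z j w o).
    case: j => [|j]; [apply: (shift_local (n := n)) => // | apply: (@act_local n) => //] => o' o'n.
      exact: serE.
    by apply: serE; exact: ltnW.
  case: j => [|j] /=; last by rewrite (act_sumr _ _ _ (fun l => iter l (act y) v)).
  rewrite /shift (act_sumr _ _ _ (fun l => iter l (act y) v)) mulr_sumr -big_split.
  by apply: eq_bigr => l _ /=; ring.
apply/funext => o; rewrite -[RHS]/(_ + _); set n := odeg o.
transitivity (\sum_(j < n.+1) exp_coef K j * Z j (Exp y v) o).
  pose F j l := exp_coef K j * (exp_coef K l * Z j (iter l (act y) v) o).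
  transitivity (\sum_(j < n.+1) \sum_(l < n.+1) F j l); last first.
    by apply: eq_bigr => j _; rewrite Zlin mulr_sumr.
  rewrite -sum_triangle => [|j l jl]; last by rewrite /F Zlow ?mulr0.
  apply: eq_bigr => k _; rewrite (iter_commutator RZ) fct_sumE mulr_sumr.
  apply: eq_bigr => j _; rewrite natmulfctE /F [RHS]mulrA -exp_coef_bin -1?ltnS //.
  by rewrite -mulr_natr; ring.
rewrite big_ord_recl exp_coef0 mul1r; congr (_ + _).
transitivity (act (fun T => \sum_(j < n) exp_coef K j.+1 * u j T) (Exp y v) o).
  by rewrite (act_suml n (Exp y v) (fun j => exp_coef K j.+1) u).
apply: (act_local (leqnn n)) => // T Tn.
rewrite (big_ord_widen n (fun j => exp_coef K j.+1 * u j T) Tn) [RHS]big_mkcond.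
apply: eq_bigr => j _; case: ltnP => // Tj.
by rewrite /u iter_bracket_low ?mulr0.
Qed.

(** * The products of the L + e i for i < k, where L = R_x - e N *)

Fixpoint shifts x (e : K) k v : V :=
  if k is i.+1 then shift x e (e * i%:R) (shifts x e i v) else v.

Lemma shifts_shift x e c k v : shifts x e k (shift x e c v) = shift x e c (shifts x e k v).
Proof. by elim: k => //= k ->; rewrite shift_comm. Qed.

Lemma shifts_low m x e k v : (forall o, (odeg o < m)%N -> v o = 0) ->
  forall o, (odeg o < m)%N -> shifts x e k v o = 0.
Proof. by move=> v0; elim: k => //= k IH o; exact: shift_low. Qed.

Lemma shifts_lead m x e k v o : (forall o, (odeg o < m)%N -> v o = 0) ->
  (odeg o <= m)%N ->
  shifts x e k v o = \prod_(i < k) (e * i%:R - e * m%:R) * v o.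
Proof.
move=> v0 om; elim: k => [|k IH]; first by rewrite big_ord0 mul1r.
rewrite /= (@shift_lead m) // ?IH; last exact: shifts_low.
by rewrite big_ord_recr /=; ring.
Qed.

(** Each factor is (q - 1)(m - i), so the k-th term is 'C(m, k) (q - 1)^k and the sum is the
    binomial expansion of (1 + (q - 1))^m; terms with k > m vanish. *)
Lemma sum_shift_coef (q : K) n m : (m <= n)%N ->
  \sum_(k < n.+1) exp_coef K k * \prod_(i < k) ((1 - q) * i%:R - (1 - q) * m%:R) = q ^+ m.
Proof.
move=> mn; have prodE k :
    \prod_(i < k) ((1 - q) * i%:R - (1 - q) * m%:R) = (q - 1) ^+ k * (m ^_ k)%:R.
  elim: k => [|k IH]; first by rewrite big_ord0 mul1r.
  rewrite big_ord_recr /= IH ffactnSr natrM exprSr.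
  have [km|mk] := leqP k m; first by rewrite natrB //; ring.
  by rewrite ffact_small // !(mulr0, mul0r).
have -> : q ^+ m = (1 + (q - 1)) ^+ m by congr (_ ^+ _); ring.
rewrite exprDn.
rewrite (big_ord_widen n.+1 (fun k => 1 ^+ (m - k) * (q - 1) ^+ k *+ 'C(m, k))) //.
rewrite [RHS]big_mkcond; apply: eq_bigr => k _; rewrite prodE -bin_ffact natrM /exp_coef.
case: ltnP => [_|mk]; last by rewrite bin_small // mul0r !mulr0.
rewrite expr1n mul1r -mulr_natr; field; exact: fact_neq0.
Qed.

(** * The identity satisfied by X = Omega_q *)

Section Key.
Variables (q : K) (X y : PL).
Local Notation B := (basis K bullet).
Local Notation e := (1 - q).
Hypothesis q1 : e != 0.
Hypothesis expid : Exp y idv = idv + emb B.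
Hypothesis eqX : Exp y (emb (dil q X)) = emb (X + prelie B X + (q - 1) \*o B).

(** [exp_shift] gives such a relation with an unknown correction R_W; evaluating it at id alone
    determines W. *)
Lemma exp_conj0 v : Exp y (shift (dil q X) e 0 v) = shift X e 0 (Exp y v).
Proof.
have [W EW] := exp_shift (dil q X) y e.
have sX w : shift X e 0 w = shift (dil q X) e 0 w + act (X - dil q X) w.
  by rewrite !shiftE actDl actNl; apply/funext => o; rewrite !fctE; ring.
suff W0 : W = X - dil q X by rewrite EW sX W0.
pose Y := W - (X - dil q X).
suff Y0 T : Y T = 0.
  by apply/eqP; rewrite -subr_eq0; apply/eqP/funext => T; exact: Y0.
(* By [expid] and [eqX], R_X - e N sends E id = id + bullet to E X[q], the term (q - 1) bullet being
   -e N bullet. Hence R_Y kills id + bullet. *)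
have eY : Y + prelie B Y = 0.
  have sid : shift (dil q X) e 0 idv = emb (dil q X).
    apply/funext => -[S|]; rewrite /shift act_idv /= /idv /= ?mulr0 ?addr0 //.
    by rewrite sub0r mulr1 oppr0 addr0.
  have sB : shift X e 0 (idv + emb B) = emb (X + prelie B X + (q - 1) \*o B).
    rewrite shiftE actDr act_idv act_emb; apply/funext => -[S|]; rewrite !fctE /=.
      rewrite /euv /idv /= ?fctE /= /basis; case: eqP => [->|_]; rewrite ?nvert_bullet /=; ring.
    by rewrite /euv /= !(mulr0, mul0r) subrr !addr0.
  have aY : act Y (idv + emb B) = 0.
    have := EW idv; rewrite sid eqX expid -(subrK (X - dil q X) W) -/Y actDl.
    rewrite addrCA [X in _ = _ + X]addrC -[X in _ = _ + X]addrC -sX sB => /eqP.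
    by rewrite -subr_eq subrr eq_sym => /eqP.
  apply/funext => S; have := congr1 (fun f : V => f (Some S)) aY.
  by rewrite actDr act_idv act_emb.
(* Y = - (bullet <| Y), whose right side starts at least one degree later than Y. *)
elim: (nvert T).+1 {-2}T (ltnSn (nvert T)) => // n IH S Sn.
have : Y S + prelie B Y S = 0 by exact: (congr1 (fun f : PL => f S) eY).
by rewrite (@prelie_low _ 1 n) ?addr0 ?add1n //; exact: low1.
Qed.

Lemma exp_conj c v : Exp y (shift (dil q X) e c v) = shift X e c (Exp y v).
Proof.
have sE x w : shift x e c w = shift x e 0 w + c \*o w.
  by apply/funext => o; rewrite -[RHS]/(_ + _) /shift /=; ring.
have ED u w : Exp y (u + w) = Exp y u + Exp y w by exact: raddfD.
by rewrite !sE ED exp_conj0 serZ.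
Qed.

Lemma dilv_shift c v : dilv q (shift X e c v) = shift (dil q X) e c (dilv q v).
Proof.
apply/funext => o; rewrite /shift -dilv_act /dilv; ring.
Qed.

(* Both sides commute with shift X e 0, which has distinct eigenvalues in
   distinct degrees, and their difference D raises the degree; hence D = 0. *)
Lemma exp_shifts n v o : (odeg o <= n)%N ->
  Exp y (dilv q v) o = \sum_(k < n.+1) exp_coef K k * shifts X e k v o.
Proof.
pose D v o := Exp y (dilv q v) o - \sum_(k < n.+1) exp_coef K k * shifts X e k v o.
(* If w starts in degree m, then [D w] vanishes up to degree m + r: induction on r, for all m. The
   bound n is where the sum over k is cut. *)
suff D0 r m w o' : (forall o, (odeg o < m)%N -> w o = 0) -> (odeg o' <= n)%N ->
    (odeg o' < m + r.+1)%N -> D w o' = 0.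
  move=> on; apply/eqP; rewrite -subr_eq0; apply/eqP.
  exact: (D0 (odeg o) 0%N v).
elim: r m w o' => [|r IH] m w o' w0 o'n o'm.
  (* In the lowest degree both sides are scalar multiples, equal by [sum_shift_coef]. *)
  have {}o'm : (odeg o' <= m)%N by move: o'm; rewrite addn1.
  rewrite /D (@ser_lead _ _ m) ?exp_coef0 //; last by move=> o'' h; rewrite /dilv w0 ?mulr0.
  under eq_bigr => k _ do rewrite (shifts_lead _ _ _ w0 o'm) mulrA.
  rewrite -mulr_suml mul1r /dilv; move: o'm; rewrite leq_eqVlt => /orP[/eqP o'm|o'm].
    by rewrite sum_shift_coef -?o'm // subrr.
  by rewrite w0 // !mulr0 subrr.
have [o'lt|o'ge] := ltnP (odeg o') (m + r.+1); first exact: IH o'lt.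
have od : odeg o' = (m + r.+1)%N.
  by apply/eqP; rewrite eqn_leq o'ge andbT -ltnS; move: o'm; rewrite addnS.
(* With this c the shift kills the degree m part of w, so the induction hypothesis applies to the
   result with m + 1. *)
pose c := e * m%:R.
have w1 : forall o, (odeg o < m.+1)%N -> shift X e c w o = 0.
  by move=> o''; rewrite ltnS => h; rewrite (shift_lead _ _ _ w0 h) subrr mul0r.
have DS : D (shift X e c w) o' = shift X e c (D w) o'.
  have -> : D w = Exp y (dilv q w) - (fun o => \sum_(k < n.+1) exp_coef K k * shifts X e k w o) by [].
  have sB u u' : shift X e c (u - u') = shift X e c u - shift X e c u' by exact: raddfB.
  rewrite sB /D dilv_shift exp_conj -[RHS]/(_ - _); congr (_ - _).
  rewrite /shift (act_sumr _ _ _ (fun k => shifts X e k w)) mulr_sumr -big_split.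
  by apply: eq_bigr => k _; rewrite shifts_shift /shift /=; ring.
move: DS; rewrite (IH m.+1) //; last by rewrite od addSn addnS.
(* [D w] vanishes in lower degrees, so only the scalar e m - e (m + r + 1) = -e (r + 1) remains,
   nonzero in characteristic 0. *)
rewrite /shift (act_local (y' := X) (v' := 0) (leqnn _)) //; last first.
  move=> o''; rewrite od => h; apply: (IH m) => //.
  by apply: leq_trans (ltnW h) _; rewrite -od.
rewrite -[act X 0 o']/(act X 0 o') raddf0 add0r /c od natrD => /esym/eqP.
rewrite mulf_eq0 => /orP[|/eqP//].
rewrite (_ : _ - _ = - (e * r.+1%:R)); last by ring.
by rewrite oppr_eq0 mulf_eq0 (negPf q1) (negPf (K0 r)).
Qed.

(** [exp_shifts] at id, which q^N fixes, combined with E id = id + bullet. *)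
Lemma exp_shifts_idv T :
  B T = \sum_(k < (nvert T).+1) exp_coef K k * shifts X e k idv (Some T).
Proof.
rewrite -exp_shifts // (_ : dilv q idv = idv).
  by rewrite expid -[RHS]/(0 + _) add0r.
by apply/funext => -[S|]; rewrite /dilv /idv ?mulr0 ?mulr1.
Qed.
End Key.

Lemma emb_low1 x o : (odeg o < 1)%N -> emb x o = 0.
Proof. by case: o => [T|] //; exact: low1. Qed.

(** As R_y id = y, (E - 1) id is (e^R - 1)/R applied to y. Writing y as R/(e^R - 1) applied to
    bullet, the two series cancel ([conv]). *)
Lemma exp_todd y : Uact (basis K bullet) (Utodd y) = y ->
  Exp y idv = idv + emb (basis K bullet).
Proof.
have conv n : \sum_(j < n.+1) exp_coef K j.+1 * todd_coef K (n - j) = (n == 0%N)%:R.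
  rewrite -todd_coefP (reindex_inj rev_ord_inj); apply: eq_bigr => j _.
  by rewrite /= subSS subKn -1?ltnS // mulrC.
move=> hy; apply/funext => -[T|]; last by rewrite ser0 exp_coef0 mul1r -[RHS]/(_ + 0) addr0.
rewrite -[RHS]/(0 + _) add0r.
transitivity (ser (fun k => exp_coef K k.+1) y (emb y) (Some T)).
  rewrite /ser [LHS]big_ord_recl [RHS]big_ord_recr.
  rewrite [X in _ = _ + X](_ : _ = 0); last first.
    by rewrite (@iter_act_low _ 1) ?mulr0 //; exact: emb_low1.
  rewrite addr0 [X in X + _ = _](_ : _ = 0) ?add0r; last exact: mulr0.
  by apply: eq_bigr => k _; rewrite lift0 iterSr act_idv.
have -> : emb y = ser (todd_coef K) y (emb (basis K bullet)).
  apply/funext => -[S|]; last by rewrite ser0 mulr0.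
  by rewrite -Uact_ser -[in LHS]hy.
rewrite ser_ser big_ord_recl [X in _ + X]big1 => [|k _].
  by rewrite big_ord_recl big_ord0 /todd_coef exp_coef1 /= !mul1r !addr0 mul1r.
by rewrite (conv (lift ord0 k)) mul0r.
Qed.
End Action.

(** * Change of base field *)

Lemma iter_act_map (K K' : fieldType) (f : {rmorphism K -> K'}) k (y : PLhat K) :
  iter k (act (f \o y)) (idv K') = f \o iter k (act y) (idv K).
Proof.
elim: k => [|k IH]; first by apply/funext => o; rewrite /= /idv rmorph_nat.
rewrite !iterS IH; apply/funext => -[T|] /=; last by rewrite rmorph0.
rewrite rmorphD rmorphM; congr (_ + _); rewrite /prelie rmorph_sum.
apply: eq_bigr => A _; rewrite rmorph_sum; apply: eq_bigr => B _ /=.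
by rewrite !rmorphM rmorph_nat.
Qed.

Lemma exp_map (K K' : fieldType) (f : {rmorphism K -> K'}) (y : PLhat K) :
  ser (exp_coef K') (f \o y) (idv K') = f \o ser (exp_coef K) y (idv K).
Proof.
apply/funext => o; rewrite /ser /= rmorph_sum; apply: eq_bigr => k _.
by rewrite iter_act_map rmorphM fmorphV rmorph_nat.
Qed.

(** * Calculus of values of rational functions at a point *)

Section Value.
Variable a : rat.
Local Notation hv := (has_value_at a).

Lemma has_value_frac (n d : {poly rat}) : d.[a] != 0 -> hv (toQq n / toQq d) (n.[a] / d.[a]).
Proof. by move=> da; exists n, d. Qed.

Lemma has_value_poly (p : {poly rat}) : hv (toQq p) p.[a].
Proof.
exists p, 1; rewrite hornerC; split; first exact: oner_neq0.
  by rewrite /toQq tofrac1 divr1.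
by rewrite divr1.
Qed.

Lemma toQq_neq0 (d : {poly rat}) : d.[a] != 0 -> toQq d != 0.
Proof.
by move=> da; rewrite tofrac_eq0; apply: contraNneq da => ->; rewrite horner0.
Qed.

Lemma has_valueD f v g w : hv f v -> hv g w -> hv (f + g) (v + w).
Proof.
move=> [n [d [da -> ->]]] [n' [d' [da' -> ->]]].
rewrite !addf_div ?toQq_neq0 // -!tofracM -tofracD -!hornerM -hornerD.
by apply: has_value_frac; rewrite hornerM mulf_neq0.
Qed.

Lemma has_valueM f v g w : hv f v -> hv g w -> hv (f * g) (v * w).
Proof.
move=> [n [d [da -> ->]]] [n' [d' [da' -> ->]]].
rewrite !mulf_div -!tofracM -!hornerM.
by apply: has_value_frac; rewrite hornerM mulf_neq0.
Qed.

Lemma has_valueV f v : v != 0 -> hv f v -> hv f^-1 v^-1.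
Proof.
move=> v0 [n [d [da -> ev]]]; rewrite ev !invf_div; apply: has_value_frac.
by apply: contraNneq v0 => na; rewrite ev na mul0r.
Qed.

Lemma has_value_nat n : hv n%:R n%:R.
Proof.
by have := has_value_poly n%:R; rewrite -[n%:R%R in X in hv _ X]polyC_natr hornerC /toQq rmorph_nat.
Qed.

Lemma has_valueB f v g w : hv f v -> hv g w -> hv (f - g) (v - w).
Proof.
move=> fv gw; apply: has_valueD => //; rewrite -mulN1r -[- w]mulN1r; apply: has_valueM => //.
by have := has_value_poly (- 1); rewrite hornerN hornerC /toQq rmorphN1.
Qed.

Lemma has_value_sum (I : eqType) (r : seq I) (F : I -> Qq) (G : I -> rat) :
  (forall i, i \in r -> hv (F i) (G i)) -> hv (\sum_(i <- r) F i) (\sum_(i <- r) G i).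
Proof.
move=> h; rewrite big_seq [X in hv _ X]big_seq.
by apply: (big_ind2 hv) => //; [exact: (has_value_nat 0) | exact: has_valueD].
Qed.

Lemma hv_exp_coef k : hv (exp_coef Qq k) (exp_coef rat k).
Proof.
by apply: has_valueV (has_value_nat _); rewrite Num.Theory.pnatr_eq0 -lt0n fact_gt0.
Qed.

Lemma has_value_prelie x y x' y' T : (forall S, (nvert S < nvert T)%N -> hv (x S) (x' S)) ->
  (forall S, (nvert S < nvert T)%N -> hv (y S) (y' S)) ->
  hv (prelie x y T) (prelie x' y' T).
Proof.
move=> hx hy; apply: has_value_sum => A; rewrite mem_trees_lt => /hx hA.
apply: has_value_sum => B; rewrite mem_trees_lt => /hy hB.
by apply: has_valueM (has_value_nat _); exact: has_valueM.
Qed.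
End Value.

(** * Regularity and value at q = 1, by induction on the degree *)

Lemma Qq_char0 n : n.+1%:R != 0 :> Qq.
Proof.
rewrite -(rmorph_nat (@FracField.tofrac {poly rat})) tofrac_eq0 -polyC_natr polyC_eq0.
by rewrite Num.Theory.pnatr_eq0.
Qed.

Theorem proposition6p1 (Omega : PLhat rat) (Omega_q : PLhat Qq)
    (HOmega : is_Omega Omega) (HOmega_q : is_Omega_q Omega Omega_q) :
  (forall T : rtree, regular_at 1 (Omega_q T)) /\
  (forall T : rtree, has_value_at 1 (Omega_q T) (Omega T)).
Proof.
suff val T : has_value_at 1 (Omega_q T) (Omega T).
  by split=> // T; have [n [d [d1 -> _]]] := val T; exists n, d.
have expid := exp_todd HOmega.
pose f : {rmorphism rat -> Qq} := @FracField.tofrac {poly rat} \o @polyC rat.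
have expidq : ser (exp_coef Qq) (ext_q Omega) (idv Qq) = idv Qq + emb (basis Qq bullet).
  rewrite (_ : ext_q Omega = f \o Omega) // exp_map expid.
  apply/funext => o; rewrite -[LHS]/(f (idv rat o + _)) -[RHS]/(_ + _) rmorphD rmorph_nat.
  by congr (_ + _); case: o => [S|]; [exact: rmorph_nat | exact: rmorph0].
have eqX : ser (exp_coef Qq) (ext_q Omega) (emb (dil qvar Omega_q)) =
    emb (Omega_q + prelie (basis Qq bullet) Omega_q + (qvar - 1) \*o basis Qq bullet).
  apply/funext => -[S|]; last by rewrite ser0 mulr0.
  (* The -1 in exp(Omega) - 1 cancels the summand [dil qvar Omega_q]. *)
  rewrite -Uact_ser; move: HOmega_q; rewrite /is_Omega_q UactBr Uact1 subrK.
  move/eqP; rewrite subr_eq => /eqP h.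
  rewrite -[Useries _ _]/(Uexp _) h /=; congr (_ S); rewrite addrC addrA //.
have q1 : 1 - qvar != 0 by rewrite -oppr_eq0 opprB -(expr1 qvar) qvar_neq1.
have hq1 : has_value_at 1 (1 - qvar) 0.
  rewrite -(subrr 1); apply: has_valueB; first exact: (has_value_nat 1 1).
  by have := has_value_poly 1 'X; rewrite hornerX.
(* At q = 1 the factors of [A k] lose their degree terms, so [a k] is its expected value. *)
pose A k := shifts Omega_q (1 - qvar) k (idv Qq).
pose a k := iter k (act Omega) (idv rat).
elim/ltn_ind: (nvert T) {-2}T (erefl (nvert T)) => {T} n IH T Tn.
(* The factor of index 0 kills the coefficient at [None], of degree 0. *)
have A0 k : A k None = (k == 0%N)%:R.
  case: k => // k; rewrite -[RHS]/(0 : Qq); elim: k => [|k IHk].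
    by rewrite /A /= /shift /= !mulr0 subrr mul0r addr0.
  by rewrite -[LHS]/(0 + _ * A k.+1 None) IHk mulr0 addr0.
have a0 k : a k None = (k == 0%N)%:R by case: k.
have hA k o : (odeg o < n)%N -> has_value_at 1 (A k o) (a k o).
  elim: k o => [|k IHk] o on; first exact: has_value_nat.
  rewrite /A /= -/(A k) /a /= -/(a k) /shift -[act Omega (a k) o]addr0.
  rewrite -(mul0r (a k o)); apply: has_valueD; last first.
    apply: has_valueM; last exact: IHk.
    rewrite -mulrBr -(mul0r (k%:R - (odeg o)%:R)); apply: has_valueM => //.
    by apply: has_valueB; exact: has_value_nat.
  case: o on => [S|] /= Sn; last exact: (has_value_nat 1 0).
  apply: has_valueD.
    rewrite A0 a0; apply: has_valueM; first exact: has_value_nat.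
    exact: IH Sn _ _.
  apply: has_value_prelie => U US; first by apply: IHk; exact: ltn_trans Sn.
  by apply: (IH (nvert U)) => //; exact: ltn_trans Sn.
(* [c k] is the coefficient of [Omega_q T] in [A k (Some T)]: the action on id produces it at the
   first step, and later factors multiply it by e (i - n), of value 0. *)
pose fix c k : Qq := if k is i.+1 then
   (i == 0%N)%:R + (1 - qvar) * (i%:R - n%:R) * c i else 0.
have h0 k (g : Qq) (v : rat) : has_value_at 1 g v ->
    has_value_at 1 ((1 - qvar) * (k%:R - n%:R) * g) 0.
  move=> gv; rewrite -(mul0r v) -(mul0r (k%:R - n%:R)).
  by apply: has_valueM => //; apply: has_valueM => //; apply: has_valueB; exact: has_value_nat.
have hc k : has_value_at 1 (c k) (k == 1%N)%:R.
  elim: k => [|k IHk]; first exact: (has_value_nat 1 0).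
  rewrite -[(k.+1 == 1%N)%:R]addr0; apply: has_valueD; first exact: has_value_nat.
  exact: h0 IHk.
(* What remains involves only components of Omega_q of degree below n. *)
have hAT k : has_value_at 1 (A k (Some T) - c k * Omega_q T)
    (a k (Some T) - (k == 1%N)%:R * Omega T).
  elim: k => [|k IHk]; first by rewrite /= !mul0r !subr0; exact: (has_value_nat 1 0).
  have -> : A k.+1 (Some T) - c k.+1 * Omega_q T = prelie (A k \o some) Omega_q T +
      (1 - qvar) * (k%:R - n%:R) * (A k (Some T) - c k * Omega_q T).
    by rewrite {1}/A /= -/(A k) /shift /= A0 Tn; ring.
  have -> : a k.+1 (Some T) - (k.+1 == 1%N)%:R * Omega T =
      prelie (a k \o some) Omega T + 0.
    by rewrite {1}/a /= -/(a k) a0 eqSS; ring.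
  apply: has_valueD; last exact: h0 IHk.
  apply: has_value_prelie => U; rewrite Tn => Un; first exact: hA.
  exact: IH Un _ _.
have n0 : (1 < n.+1)%N by rewrite ltnS -Tn nvert_gt0.
pose C := \sum_(k < n.+1) exp_coef Qq k * c k.
have hC : has_value_at 1 C 1.
  rewrite [X in has_value_at _ _ X](_ : _ =
    \sum_(k < n.+1) exp_coef rat k * (k == 1%N :> nat)%:R); last first.
    rewrite (bigD1 (Ordinal n0)) //= mulr1 exp_coef1 big1 ?addr0 // => k.
    by rewrite -val_eqE /= => /negPf->; rewrite mulr0.
  by apply: has_value_sum => k _; apply: has_valueM; [exact: hv_exp_coef | exact: hc].
(* The part of [exp_shifts_idv] free of [Omega_q T]. Its value comes from [expid], the same identity
   at q = 1, after removing the term k = 1. *)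
pose G := \sum_(k < n.+1) exp_coef Qq k * (A k (Some T) - c k * Omega_q T).
have hG : has_value_at 1 G (basis rat bullet T - Omega T).
  have -> : basis rat bullet T - Omega T =
      \sum_(k < n.+1) exp_coef rat k * (a k (Some T) - (k == 1%N :> nat)%:R * Omega T).
    under eq_bigr => k _ do rewrite mulrBr.
    rewrite sumrB; congr (_ - _).
      have := congr1 (fun v => v (Some T)) expid; rewrite /ser /= Tn => ->.
      by rewrite -[RHS]/(0 + _) add0r.
    rewrite (bigD1 (Ordinal n0)) //= exp_coef1 !mul1r big1 ?addr0 // => k.
    by rewrite -val_eqE /= => /negPf->; rewrite mul0r mulr0.
  by apply: has_value_sum => k _; apply: has_valueM; [exact: hv_exp_coef | exact: hAT].
(* A linear equation for [Omega_q T], whose leading coefficient C has value 1 at q = 1 and is thus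
   invertible there. *)
have eB : basis Qq bullet T = C * Omega_q T + G.
  rewrite (exp_shifts_idv Qq_char0 q1 expidq eqX) Tn mulr_suml -big_split.
  by apply: eq_bigr => k _; rewrite -/(A k) /=; ring.
have C0 : C != 0.
  have [p [d [d1 -> /eqP pd]]] := hC.
  have p1 : p.[1] != 0 by apply: contraTneq pd => ->; rewrite mul0r oner_eq0.
  exact: mulf_neq0 (toQq_neq0 p1) (invr_neq0 (toQq_neq0 d1)).
have -> : Omega_q T = (basis Qq bullet T - G) / C.
  by rewrite eB addrK mulrC mulKf.
rewrite -[Omega T](subKr (basis rat bullet T)) -[X in has_value_at _ _ X]divr1.
apply: has_valueM; last exact: has_valueV (oner_neq0 _) hC.
by apply: has_valueB hG; exact: has_value_nat.
Qed.
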